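(* Let $n\ge2$ and let $K\subset\mathbb{R}^n$ be a convex body. If $\partial K$ is second order differentiable at $z\in\partial K$, then $$\lim_{q\to0^+}q\,\widetilde V_{q-1}(K,z)=\frac{(n-1)\omega_{n-1}}{2n}H(z),$$ where $H(z)$ is the mean curvature of $\partial K$ at $z$ (and $q>0$ in the limit).
   Context: A convex body in $\mathbb{R}^n$ is a compact convex subset of $\mathbb{R}^n$ with nonempty interior. $\omega_m$ is the volume of the unit ball of $\mathbb{R}^m$, and $du$ is spherical Lebesgue measure on $S^{n-1}$. For $z\in K$ and $u\in S^{n-1}$, let $\rho_{K,z}(u)=\max\{\lambda\in\mathbb{R}: z+\lambda u\in K\}\ge 0$, and $S_z^+=\{u\in S^{n-1}:\rho_{K,z}(u)>0\}$. For $p\in\mathbb{R}$ and $z\in K$ the dual quermassintegral is $$\widetilde V_p(K,z)=\frac1n\int_{S_z^+}\rho_{K,z}(u)^p\,du .$$ $\partial K$ is second order differentiable at $z$ if $K$ has a unique outer unit normal $\nu_K(z)$ at $z$ and, in orthonormal coordinates with origin $z$, last basis vector $e_n=-\nu_K(z)$ and suitable $e_1,\dots,e_{n-1}$, the boundary near $z$ is the graph $y_n=f(y')$ of a convex function $f$ with $$f(y')=\tfrac12\big(\kappa_1 {y'_1}^2+\dots+\kappa_{n-1}{y'_{n-1}}^2\big)+o(|y'|^2),\qquad y'\to 0.$$ The numbers $\kappa_1,\dots,\kappa_{n-1}\ge0$ are the principal curvatures of $\partial K$ at $z$, and the mean curvature is their average $H(z)=\frac1{n-1}(\kappa_1+\dots+\kappa_{n-1})$.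 *)

(* Defs.v *)
From HB Require Import structures.
From mathcomp Require Import all_boot all_order all_algebra.
From mathcomp Require Import all_classical all_reals all_analysis.
From mathcomp Require Import measurable_realfun.

Set Implicit Arguments.
Unset Strict Implicit.
Unset Printing Implicit Defensive.

Import Order.TTheory GRing.Theory Num.Theory.
Import numFieldNormedType.Exports.

Local Open Scope classical_set_scope.
Local Open Scope ring_scope.

Section euclidean.
Context {R : realType}.

Definition dotv n (x y : 'rV[R]_n) : R := \sum_(i < n) x ord0 i * y ord0 i.

(* The library norm [`|x|] on row vectors is the sup norm; it induces the same
   topology as the Euclidean norm. *)
Definition enorm n (x : 'rV[R]_n) : R := Num.sqrt (dotv x x).

Definition unit_sphere n : set 'rV[R]_n := [set u | enorm u = 1].

Definition unit_ball n : set 'rV[R]_n := [set x | enorm x <= 1].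

End euclidean.
Arguments unit_sphere {R} n.
Arguments unit_ball {R} n.

Section measurable_rV.
Context {R : realType}.
Variable n : nat.

Let coord (i : 'I_n) (x : 'rV[R]_n) : R := x ord0 i.

Let rV_set0 : g_sigma_preimage coord set0.
Proof. exact: sigma_algebra0. Qed.

Let rV_setC A : g_sigma_preimage coord A -> g_sigma_preimage coord (~` A).
Proof. exact: sigma_algebraC. Qed.

Let rV_bigcup (F : _^nat) : (forall i, g_sigma_preimage coord (F i)) ->
  g_sigma_preimage coord (\bigcup_i (F i)).
Proof. exact: sigma_algebra_bigcup. Qed.

(* The product sigma-algebra, as for tuples in the library; it coincides with
   the Borel sigma-algebra of R^n. *)
HB.instance Definition _ :=
  @isMeasurable.Build (measure_tuple_display default_measure_display)
    'rV[R]_n (g_sigma_preimage coord) rV_set0 rV_setC rV_bigcup.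

End measurable_rV.

Section measurable_rV_lemmas.
Context {R : realType}.

Lemma measurable_coord n (i : 'I_n) :
  measurable_fun [set: 'rV[R]_n] (fun x : 'rV[R]_n => x ord0 i).
Proof.
move=> _ Y mY; rewrite setTI; apply: sub_sigma_algebra => /=.
rewrite -bigcup_seq/=; exists i => /=; first by rewrite mem_index_enum.
by exists Y => //; rewrite setTI.
Qed.

Lemma measurable_fun_rV d (T : measurableType d) n (f : T -> 'rV[R]_n) :
  (forall i, measurable_fun [set: T] (fun x => f x ord0 i)) ->
  measurable_fun [set: T] f.
Proof.
move=> mf.
suff H : g_sigma_preimage (fun (i : 'I_n) x => f x ord0 i) `<=` measurable.
  move=> _ A mA; rewrite setTI; apply: H.
  rewrite (_ : g_sigma_preimage _ =
    preimage_set_system setT f (@measurable _ 'rV[R]_n)).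
    by exists A => //; rewrite setTI.
  exact: (@g_sigma_preimage_comp _ _ _ _ (fun i (x : 'rV[R]_n) => x ord0 i)).
apply: smallest_sub; first exact: sigma_algebra_measurable.
rewrite -bigcup_seq/=; apply: bigcup_sub => i _ _ [B mB <-].
exact: mf.
Qed.

Lemma measurable_enorm n : measurable_fun [set: 'rV[R]_n] (@enorm R n).
Proof.
have dot_ge0 (x : 'rV[R]_n) : 0 <= dotv x x.
  by apply: sumr_ge0 => i _; rewrite -expr2 sqr_ge0.
rewrite (_ : @enorm R n = (fun a => a `^ 2^-1) \o (fun x => dotv x x)).
  apply: measurableT_comp; first exact: measurable_powR.
  by apply: measurable_sum => i; apply: measurable_funM; exact: measurable_coord.
by apply/funext => x /=; rewrite powR12_sqrt.
Qed.

Lemma measurable_unit_ball n : measurable (@unit_ball R n).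
Proof.
rewrite (_ : unit_ball n = setT `&` @enorm R n @^-1` `]-oo, 1]%classic).
  exact: measurable_enorm.
by rewrite setTI; apply/seteqP; split => x; rewrite /unit_ball/= in_itv.
Qed.

Definition radial n (x : 'rV[R]_n) : 'rV[R]_n := (enorm x)^-1 *: x.

Lemma measurable_radial n : measurable_fun [set: 'rV[R]_n] (@radial n).
Proof.
apply: measurable_fun_rV => i.
rewrite (_ : (fun _ => _) =
    (fun x : 'rV[R]_n => (enorm x) `^ (-1) * x ord0 i)).
  apply: measurable_funM; last exact: measurable_coord.
  apply: (@measurableT_comp _ _ _ _ _ _ (fun a : R => a `^ (-1))).
    exact: measurable_powR.
  exact: measurable_enorm.
by apply/funext => x; rewrite mxE powR_inv1// sqrtr_ge0.
Qed.

Definition consv n (p : R * 'rV[R]_n) : 'rV[R]_n.+1 :=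
  \row_(i < n.+1) (if unlift ord0 i is Some j then p.2 ord0 j else p.1).

End measurable_rV_lemmas.

Section lebesgue_rV.
Context {R : realType}.
Local Open Scope ereal_scope.

Fixpoint lebesgue_rV n : set 'rV[R]_n -> \bar R :=
  match n with
  | 0%N => \d_(0%R : 'rV[R]_0)
  | n'.+1 => pushforward (@lebesgue_measure R \x @lebesgue_rV n') (@consv R n')
  end.

Let uncons n (v : 'rV[R]_n.+1) : measurableTypeR R * 'rV[R]_n :=
  (v ord0 ord0, \row_j v ord0 (lift ord0 j)).

Let measurable_consv n :
  measurable_fun [set: measurableTypeR R * 'rV[R]_n] (@consv R n).
Proof.
apply: measurable_fun_rV => i; rewrite /consv.
under [X in measurable_fun _ X]eq_fun do rewrite mxE.
case: (unlift ord0 i) => [j|]; last exact: measurable_fst.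
apply: (@measurableT_comp _ _ _ _ _ _ (fun x : 'rV[R]_n => x ord0 j)).
  exact: measurable_coord.
exact: measurable_snd.
Qed.

Let measurable_uncons n : measurable_fun [set: 'rV[R]_n.+1] (@uncons n).
Proof.
apply/measurable_fun_pairP; split; first exact: measurable_coord.
apply: measurable_fun_rV => i.
under [X in measurable_fun _ X]eq_fun do rewrite mxE.
exact: measurable_coord.
Qed.

Let consvK n : cancel (@consv R n) (@uncons n).
Proof.
move=> [a x]; rewrite /uncons /consv mxE unlift_none /=; congr pair.
by apply/rowP => i; rewrite !mxE liftK.
Qed.

Let unconsK n : cancel (@uncons n) (@consv R n).
Proof.
move=> v; apply/rowP => i; rewrite mxE /=.
by case: unliftP => [j ->|->]; rewrite ?mxE.
Qed.

(* The library's instance of this fact on [\x] is shadowed by the one for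
   subprobability measures. *)
Let sigma_finite_prod d1 d2 (T1 : measurableType d1) (T2 : measurableType d2)
    (m1 : {sigma_finite_measure set T1 -> \bar R})
    (m2 : {sigma_finite_measure set T2 -> \bar R}) :
  sigma_finite setT (m1 \x m2).
Proof.
have /sigma_finiteP[F [TF ndF Foo]] := sigma_finiteT m1.
have /sigma_finiteP[G [TG ndG Goo]] := sigma_finiteT m2.
exists (fun k => F k `*` G k).
  rewrite -setXTT TF TG predeqE => -[x y]; split.
    move=> [/= [k _ Fkx] [l _ Gly]]; exists (maxn k l) => //; split.
    - by move: x Fkx; exact/subsetPset/ndF/leq_maxl.
    - by move: y Gly; exact/subsetPset/ndG/leq_maxr.
  by move=> [k _ []/= ? ?]; split; exists k.
move=> k; have [? ?] := Foo k; have [? ?] := Goo k.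
split; first exact: measurableX.
by rewrite product_measure1E// lte_mul_pinfty// ge0_fin_numE.
Qed.

Let lebesgue_rV_sigma_finite_measure n :
  exists m : {sigma_finite_measure set 'rV[R]_n -> \bar R},
    @lebesgue_rV n = m :> (set 'rV[R]_n -> \bar R).
Proof.
elim: n => [|n [m mE]].
  by exists (\d_(0%R : 'rV[R]_0)).
pose mu : {measure set (measurableTypeR R * 'rV[R]_n)%type -> \bar R} :=
  @lebesgue_measure R \x m.
pose nu := @lebesgue_rV n.+1.
have nuE A : nu A = mu (@consv R n @^-1` A) by rewrite /nu /= mE.
have mpre A : measurable A -> measurable (@consv R n @^-1` A).
  by move=> mA; rewrite -[X in measurable X]setTI; exact: measurable_consv.
have nu0 : nu set0 = 0 by rewrite nuE preimage_set0 measure0.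
have nu_ge0 A : 0 <= nu A by rewrite nuE.
have nu_sigma : semi_sigma_additive nu.
  move=> F mF tF mUF; rewrite nuE preimage_bigcup.
  under eq_fun do under eq_bigr do rewrite nuE.
  apply: measure_semi_sigma_additive.
  - by move=> k; exact: mpre.
  - apply/trivIsetP => /= i j _ _ ij; rewrite -preimage_setI.
    by move/trivIsetP : tF => /(_ _ _ _ _ ij) ->//; rewrite preimage_set0.
  - by rewrite -preimage_bigcup; exact: mpre.
have nu_sf : sigma_finite setT nu.
  have [F TF Foo] :=
    sigma_finite_prod (@lebesgue_measure R) m.
  exists (fun k => @uncons n @^-1` F k).
    by rewrite -preimage_bigcup -TF preimage_setT.
  move=> k; have [mF Fk] := Foo k; split.
    by rewrite -[X in measurable X]setTI; exact: measurable_uncons.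
  rewrite nuE -comp_preimage (_ : _ \o _ = id)//.
  by apply/funext => p /=; rewrite consvK.
pose nuM := isMeasure.Build _ _ _ nu nu0 nu_ge0 nu_sigma.
pose nuM' : {measure set 'rV[R]_n.+1 -> \bar R} := HB.pack nu nuM.
pose nuS := Measure_isSigmaFinite.Build _ _ _ nuM' nu_sf.
by exists (HB.pack (Measure.sort nuM') nuS : {sigma_finite_measure set 'rV[R]_n.+1 -> \bar R}).
Qed.

Let lebesgue_rV0 n : @lebesgue_rV n set0 = 0.
Proof.
by have [m ->] := lebesgue_rV_sigma_finite_measure n; rewrite measure0.
Qed.

Let lebesgue_rV_ge0 n A : 0 <= @lebesgue_rV n A.
Proof. by have [m ->] := lebesgue_rV_sigma_finite_measure n. Qed.

Let lebesgue_rV_semi_sigma_additive n : semi_sigma_additive (@lebesgue_rV n).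
Proof.
have [m ->] := lebesgue_rV_sigma_finite_measure n.
exact: measure_semi_sigma_additive.
Qed.

HB.instance Definition _ n := isMeasure.Build _ _ _ (@lebesgue_rV n)
  (lebesgue_rV0 n) (@lebesgue_rV_ge0 n) (@lebesgue_rV_semi_sigma_additive n).

Let lebesgue_rV_sigma_finite n : sigma_finite setT (@lebesgue_rV n).
Proof.
by have [m ->] := lebesgue_rV_sigma_finite_measure n; exact: sigma_finiteT.
Qed.

HB.instance Definition _ n := Measure_isSigmaFinite.Build _ _ _
  (@lebesgue_rV n) (@lebesgue_rV_sigma_finite n).

End lebesgue_rV.
Arguments lebesgue_rV {R} n.

Section sphere_measure.
Context {R : realType}.
Variable n : nat.
Local Open Scope ereal_scope.

(* Surface measure on S^{n-1}, seen as a measure on R^n carried by the sphere: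
   sigma(A) = n * vol {x : |x| <= 1, x / |x| \in A}, i.e. the measure for which
   integration in polar coordinates holds.  The origin has [radial 0 = 0],
   which is not on the sphere. *)
Definition sphere_measure (A : set 'rV[R]_n) : \bar R :=
  n%:R%:E * lebesgue_rV n (@radial R n @^-1` A `&` unit_ball n).

Let ball_measure : {measure set 'rV[R]_n -> \bar R} :=
  mrestr (lebesgue_rV n) (@measurable_unit_ball R n).

Let measurable_radial_pre (A : set 'rV[R]_n) :
  measurable A -> measurable (@radial R n @^-1` A).
Proof.
by move=> mA; rewrite -[X in measurable X]setTI; exact: measurable_radial.
Qed.

Let sphere_measure0 : sphere_measure set0 = 0.
Proof. by rewrite /sphere_measure preimage_set0 set0I measure0 mule0. Qed.

Let sphere_measure_ge0 A : 0 <= sphere_measure A.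
Proof. by rewrite mule_ge0// lee_fin. Qed.

Let sphere_measure_semi_sigma_additive : semi_sigma_additive sphere_measure.
Proof.
move=> F mF tF mUF.
rewrite (_ : (fun k => _) = (fun k => n%:R%:E *
    \sum_(0 <= i < k) ball_measure (@radial R n @^-1` F i))); last first.
  by apply/funext => k; rewrite ge0_sume_distrr.
apply: cvgeZl => //; rewrite preimage_bigcup.
apply: (@measure_semi_sigma_additive _ _ _ ball_measure).
- by move=> k; exact: measurable_radial_pre.
- apply/trivIsetP => /= i j _ _ ij; rewrite -preimage_setI.
  by move/trivIsetP : tF => /(_ _ _ _ _ ij) ->//; rewrite preimage_set0.
- by rewrite -preimage_bigcup; exact: measurable_radial_pre.
Qed.

HB.instance Definition _ := isMeasure.Build _ _ _ sphere_measure
  sphere_measure0 sphere_measure_ge0 sphere_measure_semi_sigma_additive.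

End sphere_measure.
Arguments sphere_measure {R} n.

Section convex_bodies.
Context {R : realType}.

Definition ball_volume (m : nat) : R := fine (lebesgue_rV m (unit_ball m)).

Definition convex_body n (K : set 'rV[R]_n) : Prop :=
  [/\ compact K, convex_set K & K° !=set0].

Definition boundary n (K : set 'rV[R]_n) : set 'rV[R]_n :=
  closure K `\` K°.

(* For K compact, z \in K and u != 0 the supremum is attained. *)
Definition radial_function n (K : set 'rV[R]_n) (z u : 'rV[R]_n) : R :=
  sup [set l : R | K (z + l *: u)].

Definition positive_directions n (K : set 'rV[R]_n) (z : 'rV[R]_n) :
    set 'rV[R]_n :=
  [set u | unit_sphere n u /\ 0 < radial_function K z u].

(* Extended-real valued, since the integral may diverge for p < 0. *)
Definition dual_quermassintegral n (p : R) (K : set 'rV[R]_n) (z : 'rV[R]_n) :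
    \bar R :=
  ((n%:R^-1)%:E *
   \int[sphere_measure n]_(u in positive_directions K z)
     (radial_function K z u `^ p)%:E)%E.

Definition outer_unit_normals n (K : set 'rV[R]_n) (z : 'rV[R]_n) :
    set 'rV[R]_n :=
  [set nu | unit_sphere n nu /\ forall y, K y -> dotv (y - z) nu <= 0].

(* [principal_curvatures K z kappa]: the boundary of K is second order
   differentiable at z, with principal curvatures kappa.  The rows of E are the
   tangential vectors e_1, ..., e_{n-1}; together with e_n = - nu they form an
   orthonormal basis, and y has coordinates y' = (y - z) *m E^T and
   y_n = dotv (y - z) (- nu) with respect to the origin z. *)
Definition principal_curvatures n (K : set 'rV[R]_n) (z : 'rV[R]_n)
    (kappa : 'rV[R]_n.-1) : Prop :=
  exists (nu : 'rV[R]_n) (E : 'M[R]_(n.-1, n)) (f : 'rV[R]_n.-1 -> R),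
    [/\ outer_unit_normals K z = [set nu],
        E *m E^T = 1%:M /\ nu *m E^T = 0,
        exists2 U : set 'rV[R]_n.-1, nbhs (0 : 'rV[R]_n.-1) U &
          convex_set U /\ convex_function U f,
        \forall y \near z,
          boundary K y <-> dotv (y - z) (- nu) = f ((y - z) *m E^T) &
        (fun y => f y - 2^-1 * \sum_i kappa ord0 i * y ord0 i ^+ 2 : R^o)
          =o_ (0 : 'rV[R]_n.-1) (fun y => enorm y ^+ 2 : R^o)].

Definition mean_curvature n (kappa : 'rV[R]_n.-1) : R :=
  n.-1%:R^-1 * \sum_i kappa ord0 i.

End convex_bodies.

(* Main.v *)
Require Import Defs.
From mathcomp Require Import all_boot all_order all_fingroup all_algebra.
From mathcomp Require Import all_classical all_reals all_analysis.
From mathcomp Require Import measurable_realfun.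
From mathcomp Require Import ring lra.

Import Order.TTheory GRing.Theory Num.Theory.
Import numFieldNormedType.Exports.

Set Implicit Arguments.
Unset Strict Implicit.
Unset Printing Implicit Defensive.

Local Open Scope classical_set_scope.
Local Open Scope ring_scope.

(** Why the theorem holds. Describe a direction by its height [t] above the
    tangent hyperplane at [z] and its tangential part [v]. Directions with
    [t < 0] do not enter [K]. For [t > 0] small the ray of direction [(t, v)]
    leaves [K] at the distance [r] where [r t = f (r v)], and
    [f (r v) ~ r^2 k(v)] with [k(v) = 1/2 \sum_i kappa_i v_i^2]; so the radial
    function is about [t / k(v)] and its power [q - 1] about
    [k(v)^(1 - q) t^(q - 1)]. As [q] tends to [0] the density [q t^(q - 1)] on
    [0 < t <= 1] has mass [1] and concentrates at [t = 0]. Thus [q] times the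
    integral retains only the average of [k] over the equator [t = 0], and
    averaging [kappa_i v_i^2] produces the sum of the principal curvatures.

    To make this rigorous without polar coordinates, the spherical integral is
    rewritten, from the definition of the surface measure through cones, as an
    integral over the unit ball of a function constant on rays. Lebesgue measure
    is rotation invariant ([orthogonal_scales_volume]), so the frame at [z] may
    be taken as coordinate frame, and the domain becomes the half ball
    [t > 0] ([dual_quermassintegral_half_ball]).

    Convexity locates [K] near [z] on the upper side of the graph of [f]
    ([graph_local]); with the second order expansion this pinches the radial
    function, up to an error [e |v|^2] in the quadratic form and a threshold [d]
    below which the expansion is valid ([radial_function_bounds]). Directions
    whose radial function exceeds [d] contribute at most [d^(q - 1)] to the
    integrand, which disappears after multiplication by [q].

    The half ball lies inside the cylinder [|v| <= 1, 0 < t <= 1] and contains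
    the region [|v| <= 1/(1 + c), 0 < t <= c |v|], on which [|x|] is at most
    [(1 + c) |v|]. On both regions the bounds for the integrand separate into a
    power of [t] and a function of [v], so the integral in [t] is explicit
    ([integral_subgraph_powR]), and what remains is
    [\int_(|v| <= a) k(v) / |v| dv] ([integral_half_form_ballr]), computed by
    a layer-cake argument and the symmetry between coordinates. Letting [q],
    then [e] and [c], tend to [0] gives the limit ([half_ball_limit]). *)

(** * One-dimensional Lebesgue measure under affine maps *)

Section affine_maps.
Context {R : realType}.
Local Notation lam := (@lebesgue_measure R).

Lemma measurable_affine (a b : R) :
  measurable_fun [set: measurableTypeR R]
    (fun x : measurableTypeR R => a * x + b : measurableTypeR R).
Proof. by apply: measurable_funD => //; exact: measurable_funM. Qed.

(** Both sides are measures, so it suffices to compare them on half-open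
    intervals; a negative slope exchanges which end is open. *)
Lemma lebesgue_measure_affine (a b : R) (A : set (measurableTypeR R)) : a != 0 ->
  measurable A ->
  lam ((fun x => a * x + b) @^-1` A) = (`|a|^-1%:E * lam A)%E.
Proof.
move=> a0 mA.
have na0 : 0 < `|a| by rewrite normr_gt0.
pose mu := @mscale _ _ R (NngNum (normr_ge0 a))
  (pushforward lam (fun x => a * x + b : measurableTypeR R)).
have H : lam A = mu (@measurable_affine a b) A.
  apply: lebesgue_measure_unique mA => X [[c d] _ <-].
  rewrite /mu /= /mscale/= /pushforward /= lebesgue_measure_itv/= lte_fin.
  have [pa|] := ltP 0 a.
    rewrite (_ : _ @^-1` _ = [set` `](c - b) / a, (d - b) / a]]); last first.
      apply/seteqP; split => x /=; rewrite !in_itv/= ltr_pdivrMr// ler_pdivlMr//.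
        by rewrite ltrBlDr lerBrDr mulrC.
      by rewrite ltrBlDr lerBrDr mulrC.
    rewrite lebesgue_measure_itv/= lte_fin ltr_pM2r ?invr_gt0// ltrD2r.
    case: ifP => cd; last by rewrite mule0.
    rewrite !EFinN -?EFinB -EFinM gtr0_norm//; congr EFin; field; lra.
  rewrite le_eqVlt (negbTE a0)/= => pa.
  rewrite (_ : _ @^-1` _ = [set` `[(d - b) / a, (c - b) / a[]); last first.
    apply/seteqP; split => x /=; rewrite !in_itv/= ltr_ndivlMr// ler_ndivrMr//.
      by rewrite ltrBlDr lerBrDr mulrC andbC.
    by rewrite ltrBlDr lerBrDr mulrC andbC.
  rewrite lebesgue_measure_itv/= lte_fin ltr_nM2r ?invr_lt0// ltrD2r.
  case: ifP => cd; last by rewrite mule0.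
  by rewrite !EFinN -?EFinB -EFinM ltr0_norm//; congr EFin; field; lra.
rewrite H /mu /mscale/= /pushforward muleA -EFinM mulVf ?mul1e//.
exact: lt0r_neq0.
Qed.

End affine_maps.

(** * Volume in R^n under linear maps *)

Section linear_maps.
Context {R : realType}.
Local Notation lam := (@lebesgue_measure R).

Lemma measurable_consv n :
  measurable_fun [set: measurableTypeR R * 'rV[R]_n] (@consv R n).
Proof.
apply: measurable_fun_rV => i; rewrite /consv.
under [X in measurable_fun _ X]eq_fun do rewrite mxE.
case: (unlift ord0 i) => [j|]; last exact: measurable_fst.
apply: (@measurableT_comp _ _ _ _ _ _ (fun x : 'rV[R]_n => x ord0 j)).
  exact: measurable_coord.
exact: measurable_snd.
Qed.

Lemma measurable_pre d d' (T : measurableType d) (T' : measurableType d')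
    (f : T -> T') (A : set T') : measurable_fun setT f -> measurable A ->
  measurable (f @^-1` A).
Proof. by move=> mf mA; rewrite -[X in measurable X]setTI; exact: mf. Qed.

Lemma lebesgue_rVS n (A : set 'rV[R]_n.+1) :
  lebesgue_rV n.+1 A =
  (\int[lam]_x lebesgue_rV n [set v | A (consv (x, v))])%E.
Proof.
rewrite /= /pushforward /product_measure1/=; apply: eq_integral => x _ /=.
congr (lebesgue_rV n _); apply/seteqP; split => v /=; rewrite /xsection/= ?inE//.
Qed.

Lemma lebesgue_rVSr n (A : set 'rV[R]_n.+1) : measurable A ->
  lebesgue_rV n.+1 A =
  (\int[lebesgue_rV n]_v lam [set x | A (consv (x, v))])%E.
Proof.
move=> mA; rewrite /= /pushforward.
have := @product_measure_unique _ _ _ _ R lam (lebesgue_rV n)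
  (product_measure2 lam (lebesgue_rV n)) _ _ (measurable_pre (@measurable_consv n) mA).
move=> ->; last first.
  by move=> B C mB mC; exact: product_measure2E.
rewrite /product_measure2/=; apply: eq_integral => x _ /=.
congr (lam _); apply/seteqP; split => v /=; rewrite /ysection/= ?inE//.
Qed.

Lemma measurable_section n (A : set 'rV[R]_n.+1) x : measurable A ->
  measurable [set v | A (consv (x, v))].
Proof.
move=> /(measurable_pre (@measurable_consv n)) /(measurable_xsection x).
by rewrite /xsection/=; congr measurable; apply/seteqP; split => v /=; rewrite inE.
Qed.

Lemma measurable_sectionr n (A : set 'rV[R]_n.+1) v : measurable A ->
  measurable ([set x | A (consv (x, v))] : set (measurableTypeR R)).
Proof.
move=> /(measurable_pre (@measurable_consv n)) /(measurable_ysection v).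
by rewrite /ysection/=; congr measurable; apply/seteqP; split => x /=; rewrite inE.
Qed.

Lemma measurable_fun_section n (A : set 'rV[R]_n.+1) : measurable A ->
  measurable_fun setT (fun x : measurableTypeR R =>
    lebesgue_rV n [set v | A (consv (x, v))]).
Proof.
move=> /(measurable_pre (@measurable_consv n)).
move=> /(measurable_fun_xsection (lebesgue_rV n)).
congr measurable_fun; apply/funext => x /=; congr (lebesgue_rV n _).
by rewrite /xsection/=; apply/seteqP; split => v /=; rewrite inE.
Qed.

Lemma measurable_fun_sectionr n (A : set 'rV[R]_n.+1) : measurable A ->
  measurable_fun setT (fun v : 'rV[R]_n => lam [set x | A (consv (x, v))]).
Proof.
move=> /(measurable_pre (@measurable_consv n)).
move=> /(measurable_fun_ysection lam).
congr measurable_fun; apply/funext => x /=; congr (lam _).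
by rewrite /ysection/=; apply/seteqP; split => v /=; rewrite inE.
Qed.

(** Compositions of such maps are of the same kind, so the constant of a
    linear map can be left unevaluated until a test set determines it. *)
Definition scales_volume n (T : 'rV[R]_n -> 'rV[R]_n) (c : R) :=
  forall A, measurable A -> lebesgue_rV n (T @^-1` A) = (c%:E * lebesgue_rV n A)%E.

Lemma measurable_affine_rV n p (M : 'M[R]_(n, p)) (w : 'rV[R]_p) :
  measurable_fun [set: 'rV[R]_n] (fun x : 'rV[R]_n => x *m M + w).
Proof.
apply: measurable_fun_rV => i.
under [X in measurable_fun _ X]eq_fun do rewrite !mxE.
apply: measurable_funD => //; apply: measurable_sum => j.
by apply: measurable_funM => //; exact: measurable_coord.
Qed.

Lemma measurable_mulmxr n p (M : 'M[R]_(n, p)) :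
  measurable_fun [set: 'rV[R]_n] (fun x : 'rV[R]_n => x *m M).
Proof.
have := measurable_affine_rV M 0.
by congr measurable_fun; apply/funext => x; rewrite addr0.
Qed.

Lemma scales_volume_comp n (T U : 'rV[R]_n -> 'rV[R]_n) c d :
  measurable_fun setT U ->
  scales_volume T c -> scales_volume U d -> scales_volume (U \o T) (c * d).
Proof.
move=> mU hT hU A mA.
have -> : (U \o T) @^-1` A = T @^-1` (U @^-1` A) by [].
rewrite hT ?hU ?muleA//; exact: measurable_pre.
Qed.

(** Integrating over the first coordinate last, the inner volumes are all
    multiplied by the same factor. *)
Lemma scales_volume_skewl n (T : 'rV[R]_n.+1 -> 'rV[R]_n.+1)
    (b : R -> 'rV[R]_n -> 'rV[R]_n) c : 0 <= c ->
  (forall x, scales_volume (b x) c) ->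
  (forall x v, T (consv (x, v)) = consv (x, b x v)) ->
  scales_volume T c.
Proof.
move=> c0 hb hT A mA; rewrite !lebesgue_rVS.
rewrite -ge0_integralZl//; last exact: measurable_fun_section.
apply: eq_integral => x _; rewrite -(hb x); last exact: measurable_section.
by congr (lebesgue_rV n _); apply/seteqP; split => v /=; rewrite hT.
Qed.

(** Integrating over the first coordinate first, each fibre undergoes an affine
    change of variable of slope [a]. *)
Lemma scales_volume_skewr n (T : 'rV[R]_n.+1 -> 'rV[R]_n.+1)
    (a : R) (b : 'rV[R]_n -> R) : a != 0 -> measurable_fun setT T ->
  (forall x v, T (consv (x, v)) = consv (a * x + b v, v)) ->
  scales_volume T `|a|^-1.
Proof.
move=> a0 mT hT A mA.
rewrite !lebesgue_rVSr//; last exact: measurable_pre.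
rewrite -ge0_integralZl//; last exact: measurable_fun_sectionr.
apply: eq_integral => v _; rewrite -(lebesgue_measure_affine (b v) a0); last first.
  exact: measurable_sectionr.
by congr (lam _); apply/seteqP; split => x /=; rewrite hT.
Qed.

Lemma consv_surj n (x : 'rV[R]_n.+1) :
  x = consv (x ord0 ord0, \row_j x ord0 (lift ord0 j)).
Proof.
by apply/rowP => i; rewrite mxE /=; case: unliftP => [j ->|->]; rewrite ?mxE.
Qed.

Lemma consv_row_mx n (x : R) (v : 'rV[R]_n) :
  consv (x, v) = row_mx (x%:M : 'M[R]_1) v :> 'rV_(1 + n).
Proof.
apply/rowP => i; rewrite mxE /=; case: unliftP => [j ->|->].
  by rewrite (_ : lift ord0 j = rshift 1 j) ?row_mxEr//; exact/val_inj.
by rewrite (_ : @ord0 n = @lshift 1 n ord0) ?row_mxEl ?mxE ?eqxx//; exact/val_inj.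
Qed.

Lemma scales_volume_translation n (w : 'rV[R]_n) : scales_volume (fun x : 'rV[R]_n => x + w) 1.
Proof.
elim: n w => [|n IH] w.
  move=> A mA; rewrite mul1e; congr lebesgue_rV; apply/seteqP.
  by split => x /=; rewrite (thinmx0 w) addr0.
pose T0 (x : 'rV[R]_n.+1) := x + consv (0, \row_j w ord0 (lift ord0 j)).
pose T1 (x : 'rV[R]_n.+1) := x + consv (w ord0 ord0, 0).
have mtr (u : 'rV[R]_n.+1) : measurable_fun setT (fun x : 'rV[R]_n.+1 => x + u).
  have := measurable_affine_rV 1%:M u.
  by congr measurable_fun; apply/funext => x; rewrite mulmx1.
have -> : (fun x : 'rV[R]_n.+1 => x + w) = T1 \o T0.
  apply/funext => x; rewrite /T1/T0/= -addrA; congr (_ + _).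
  apply/rowP => i; rewrite !mxE/=; case: unliftP => [j ->|->]; rewrite ?mxE ?addr0 ?add0r//.
rewrite -[1]mulr1; apply: scales_volume_comp; first exact: mtr.
  apply: (@scales_volume_skewl _ _ (fun _ v => v + \row_j w ord0 (lift ord0 j))) => //.
  move=> x v; rewrite /T0; apply/rowP => i; rewrite !mxE/=; case: unliftP => [j _|_];
  by rewrite ?mxE ?addr0 ?add0r//.
rewrite -[1]invr1 -[X in X^-1]normr1.
apply: (@scales_volume_skewr _ _ 1 (fun=> w ord0 ord0)); rewrite ?oner_neq0//.
  exact: mtr.
move=> x v; rewrite /T1; apply/rowP => i; rewrite !mxE/=; case: unliftP => [j _|_];
  by rewrite ?mxE ?addr0 ?mul1r.
Qed.

Lemma scales_volume_dilation n (r : R) : 0 < r -> scales_volume (@GRing.scale _ 'rV[R]_n r) (r ^- n).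
Proof.
move=> r0; elim: n => [|n IH].
  move=> A mA; rewrite expr0 invr1 mul1e; congr lebesgue_rV; apply/seteqP.
  by split => x /=; rewrite (thinmx0 x) scaler0.
pose T0 (x : 'rV[R]_n.+1) := x *m (block_mx 1%:M 0 0 r%:M : 'M[R]_(1 + n)).
pose T1 (x : 'rV[R]_n.+1) := x *m (block_mx r%:M 0 0 1%:M : 'M[R]_(1 + n)).
have -> : *:%R r = T1 \o T0.
  apply/funext => x; rewrite /T1/T0/= -mulmxA (@mulmx_block _ 1 n 1 n 1 n) !mulmx0 !mul0mx !addr0 !add0r.
  by rewrite mulmx1 mul1mx -scalar_mx_block mul_mx_scalar.
rewrite exprSr invfM; apply: scales_volume_comp; first exact: measurable_mulmxr.
  apply: (@scales_volume_skewl _ _ (fun _ v => r *: v)) => //.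
    by rewrite invr_ge0 exprn_ge0// ltW.
  move=> x v; rewrite /T0 !consv_row_mx (@mul_row_block _ 1 1 n 1 n) !mulmx0 mulmx1 addr0 add0r.
  by rewrite mul_mx_scalar.
rewrite -[in r^-1](gtr0_norm r0).
apply: (@scales_volume_skewr _ _ r (fun=> 0)); rewrite ?lt0r_neq0//.
  exact: measurable_mulmxr.
move=> x v; rewrite /T1 !consv_row_mx (@mul_row_block _ 1 1 n 1 n) !mulmx0 mulmx1 addr0 !add0r.
by rewrite addr0 -scalar_mxM mulrC.
Qed.

(** Induction on the size. With a nonzero upper left entry [a], the matrix is
    the product of a lower block shear, of the block diagonal matrix of [a] and
    the Schur complement, and of an upper block shear; each factor is one of the
    skew maps above. Adding another row to the first one provides a nonzero
    entry. *)
Lemma unitmx_scales_volume n (M : 'M[R]_n) : M \in unitmx ->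
  exists2 c, 0 <= c & scales_volume (fun x : 'rV[R]_n => x *m M) c.
Proof.
elim: n M => [|n IH] M uM.
  exists 1 => // A mA; rewrite mul1e; congr lebesgue_rV; apply/seteqP.
  by split => x /=; rewrite (thinmx0 (x *m M)) (thinmx0 x).
have comp (P Q : 'M[R]_n.+1) :
    (exists2 c, 0 <= c & scales_volume (fun x : 'rV[R]_n.+1 => x *m P) c) ->
    (exists2 c, 0 <= c & scales_volume (fun x : 'rV[R]_n.+1 => x *m Q) c) ->
    exists2 c, 0 <= c & scales_volume (fun x : 'rV[R]_n.+1 => x *m (P *m Q)) c.
  move=> [c c0 hc] [d d0 hd]; exists (c * d); first exact: mulr_ge0.
  have := scales_volume_comp (measurable_mulmxr Q) hc hd.
  by congr scales_volume; apply/funext => x /=; rewrite mulmxA.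
have upper (w : 'rV[R]_n) : exists2 c, 0 <= c & scales_volume
    (fun x : 'rV[R]_n.+1 => x *m (block_mx 1%:M w 0 1%:M : 'M[R]_(1 + n))) c.
  exists 1 => //; apply: (@scales_volume_skewl _ _ (fun x v => v + x *: w)) => //.
    by move=> x; exact: scales_volume_translation.
  move=> x v; rewrite !consv_row_mx (@mul_row_block _ 1 1 n 1 n) !mulmx0 !mulmx1 addr0.
  by rewrite mul_scalar_mx addrC.
have lower (w : 'cV[R]_n) : exists2 c, 0 <= c & scales_volume
    (fun x : 'rV[R]_n.+1 => x *m (block_mx 1%:M 0 w 1%:M : 'M[R]_(1 + n))) c.
  exists `|1|^-1; first by rewrite normr1 invr1.
  apply: (@scales_volume_skewr _ _ 1 (fun v => (v *m w) ord0 ord0)); rewrite ?oner_neq0//.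
    exact: measurable_mulmxr.
  move=> x v; rewrite !consv_row_mx (@mul_row_block _ 1 1 n 1 n) !mulmx0 !mulmx1 add0r mul1r.
  by rewrite [X in _ + X](mx11_scalar (v *m w)) -raddfD.
have diag (a : R) (D : 'M[R]_n) : a != 0 -> D \in unitmx -> exists2 c, 0 <= c & scales_volume
    (fun x : 'rV[R]_n.+1 => x *m (block_mx a%:M 0 0 D : 'M[R]_(1 + n))) c.
  move=> a0 uD; have -> : (block_mx a%:M 0 0 D : 'M[R]_(1 + n)) =
     (block_mx a%:M 0 0 1%:M : 'M[R]_(1 + n)) *m (block_mx 1%:M 0 0 D : 'M[R]_(1 + n)).
     rewrite (@mulmx_block _ 1 n 1 n 1 n) !mulmx0 !mul0mx !addr0 !add0r.
     by rewrite mulmx1 mul1mx.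
  apply: comp.
    exists `|a|^-1; first by rewrite invr_ge0.
    apply: (@scales_volume_skewr _ _ a (fun=> 0)) => //; first exact: measurable_mulmxr.
    move=> x v; rewrite !consv_row_mx (@mul_row_block _ 1 1 n 1 n) !mulmx0 !mulmx1 !addr0 add0r.
    by rewrite -scalar_mxM mulrC.
  have [c c0 hc] := IH _ uD; exists c => //.
  apply: (@scales_volume_skewl _ _ (fun x v => v *m D)) => //.
  by move=> x v; rewrite !consv_row_mx (@mul_row_block _ 1 1 n 1 n) !mulmx0 !mulmx1 addr0 add0r.
have pivot (P : 'M[R]_(1 + n)) : P \in unitmx -> P ord0 ord0 != 0 ->
    exists2 c, 0 <= c & scales_volume (fun x : 'rV[R]_n.+1 => x *m P) c.
  move=> uP; rewrite -(submxK P).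
  set a := ulsubmx P; set r := ursubmx P; set d := dlsubmx P; set D := drsubmx P.
  have -> : block_mx a r d D ord0 ord0 = a ord0 ord0.
    by rewrite (_ : @ord0 n = @lshift 1 n ord0) ?block_mxEul//; exact/val_inj.
  set s := a ord0 ord0 => s0.
  have aE : a = s%:M by rewrite (mx11_scalar a).
  have PE : block_mx a r d D = (block_mx 1%:M 0 (s^-1 *: d) 1%:M : 'M[R]_(1 + n)) *m
      ((block_mx s%:M 0 0 (D - s^-1 *: (d *m r)) : 'M[R]_(1 + n)) *m
      (block_mx 1%:M (s^-1 *: r) 0 1%:M : 'M[R]_(1 + n))).
    rewrite (@mulmx_block _ 1 n 1 n 1 n) (@mulmx_block _ 1 n 1 n 1 n) !mulmx0 !mul0mx !addr0 !add0r.
    rewrite !mulmx1 !mul1mx mul_scalar_mx mul_mx_scalar !scalerA mulfV// !scale1r.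
    by rewrite -scalemxAl addr0 [_ + (D - _)]addrC subrK aE.
  rewrite PE; apply: (comp) => //; apply: (comp) => //; apply: diag => //.
  move: uP; rewrite -{1}(submxK P) -/a -/r -/d -/D PE !unitmx_mul => /and3P[_ + _].
  by rewrite unitmxE (det_ublock s%:M) unitrM -unitmxE => /andP[].
have [M0|] := eqVneq (M ord0 ord0) 0; last exact: pivot.
have [j Mj] : exists j : 'I_n, M (lift ord0 j) ord0 != 0.
  apply: contrapT => /forallNP H.
  have : M^T \in unitmx by rewrite unitmx_tr.
  move=> /mulmxV /matrixP /(_ ord0 ord0); rewrite !mxE/= big1; last first.
    move=> i _; rewrite !mxE; case: (unliftP ord0 i) => [k ->|->]; last by rewrite M0 mul0r.
    by have := H k => /negP; rewrite negbK => /eqP ->; rewrite mul0r.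
  by move=> /eqP; rewrite eq_sym oner_eq0.
pose U (s : R) : 'M[R]_(1 + n) := block_mx 1%:M (s *: delta_mx ord0 j) 0 1%:M.
have UU s : U (- s) *m U s = 1%:M.
  rewrite /U (@mulmx_block _ 1 n 1 n 1 n) !mulmx0 !mul0mx !addr0 !add0r !mulmx1 !mul1mx.
  by rewrite scaleNr subrr -scalar_mx_block.
have -> : M = U (-1) *m (U 1 *m M) by rewrite mulmxA UU mul1mx.
apply: (comp) => //; first exact: upper.
apply: pivot.
  by rewrite unitmx_mul uM andbT; have := UU 1 => /mulmx1_unit[].
have U0 : U 1 ord0 ord0 = 1.
  by rewrite /U (_ : @ord0 n = @lshift 1 n ord0) ?block_mxEul ?mxE//; exact/val_inj.
have U1 k : U 1 ord0 (lift ord0 k) = (k == j)%:R.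
  rewrite /U (_ : lift ord0 k = rshift 1 k); last exact/val_inj.
  rewrite (_ : @ord0 n = @lshift 1 n ord0); last exact/val_inj.
  by rewrite block_mxEur !mxE eqxx mul1r.
rewrite mxE big_ord_recl U0 M0 mulr0 add0r (bigD1 j)//= big1 => [|k kj].
  by rewrite U1 eqxx mul1r addr0.
by rewrite U1 (negbTE kj) mul0r.
Qed.

End linear_maps.

(** * Euclidean norm *)

Section euclid.
Context {R : realType}.
Implicit Types n : nat.

Lemma dotv_ge0 n (x : 'rV[R]_n) : 0 <= dotv x x.
Proof. by apply: sumr_ge0 => i _; rewrite -expr2 sqr_ge0. Qed.

Lemma enorm_ge0 n (x : 'rV[R]_n) : 0 <= enorm x.
Proof. exact: sqrtr_ge0. Qed.

Lemma sqr_enorm n (x : 'rV[R]_n) : enorm x ^+ 2 = dotv x x.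
Proof. by rewrite sqr_sqrtr// dotv_ge0. Qed.

Lemma dotvE n (x y : 'rV[R]_n) : dotv x y = (x *m y^T) ord0 ord0.
Proof. by rewrite mxE; apply: eq_bigr => i _; rewrite mxE. Qed.

Lemma dotvDl n (x y w : 'rV[R]_n) : dotv (x + y) w = dotv x w + dotv y w.
Proof. by rewrite !dotvE mulmxDl mxE. Qed.

Lemma dotvZl n a (x w : 'rV[R]_n) : dotv (a *: x) w = a * dotv x w.
Proof. by rewrite !dotvE -scalemxAl mxE. Qed.

Lemma dotvZr n a (x w : 'rV[R]_n) : dotv x (a *: w) = a * dotv x w.
Proof. by rewrite !dotvE linearZ/= -scalemxAr mxE. Qed.

Lemma dotvNr n (x w : 'rV[R]_n) : dotv x (- w) = - dotv x w.
Proof. by rewrite -scaleN1r dotvZr mulN1r. Qed.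

Lemma enormZ n a (x : 'rV[R]_n) : enorm (a *: x) = `|a| * enorm x.
Proof.
by rewrite /enorm dotvZl dotvZr mulrA -expr2 sqrtrM ?sqr_ge0// sqrtr_sqr.
Qed.

Lemma enorm0 n : enorm (0 : 'rV[R]_n) = 0.
Proof. by rewrite -(scale0r 0) enormZ normr0 mul0r. Qed.

Lemma coord_le_enorm n (x : 'rV[R]_n) i : `|x ord0 i| <= enorm x.
Proof.
rewrite -(ler_pXn2r (_ : 0 < 2)%N) ?nnegrE ?enorm_ge0// real_normK ?num_real//.
rewrite sqr_enorm /dotv (bigD1 i)//= -expr2 lerDl sumr_ge0// => j _.
by rewrite -expr2 sqr_ge0.
Qed.

Lemma enorm_eq0 n (x : 'rV[R]_n) : (enorm x == 0) = (x == 0).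
Proof.
apply/eqP/eqP => [x0|->]; last exact: enorm0.
apply/rowP => i; rewrite mxE; apply/eqP; rewrite -normr_le0 -x0.
exact: coord_le_enorm.
Qed.

Lemma mxnorm_le_enorm n (x : 'rV[R]_n) : `|x| <= enorm x.
Proof.
rewrite /Num.norm/= mx_normrE; apply: bigmax_le; first exact: enorm_ge0.
by move=> [i j] _ /=; rewrite ord1; exact: coord_le_enorm.
Qed.

Lemma coord_le_mxnorm n (x : 'rV[R]_n) i : `|x ord0 i| <= `|x|.
Proof.
rewrite [leRHS]/Num.norm/= mx_normrE.
exact: (le_bigmax _ (fun ij : 'I_1 * 'I_n => `|x ij.1 ij.2|) (ord0, i)).
Qed.

Lemma sqr_enorm_le n (x : 'rV[R]_n) r : (forall i, `|x ord0 i| <= r) ->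
  enorm x ^+ 2 <= n%:R * r ^+ 2.
Proof.
move=> xr; rewrite sqr_enorm /dotv mulr_natl -[n in leRHS]card_ord -sumr_const.
apply: ler_sum => i _; rewrite -expr2 -real_normK ?num_real//.
by rewrite lerXn2r ?nnegrE// (le_trans _ (xr i)).
Qed.

Lemma enorm_mulmx n m (M : 'M[R]_(n, m)) (x : 'rV[R]_n) : M *m M^T = 1%:M ->
  enorm (x *m M) = enorm x.
Proof.
move=> MM; rewrite /enorm !dotvE trmx_mul mulmxA -(mulmxA x) MM mulmx1//.
Qed.

Lemma sqr_enorm_consv n (t : R) (v : 'rV[R]_n) :
  enorm (consv (t, v)) ^+ 2 = t ^+ 2 + enorm v ^+ 2.
Proof.
rewrite !sqr_enorm /dotv big_ord_recl !mxE unlift_none/= -expr2; congr (_ + _).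
by apply: eq_bigr => i _; rewrite !mxE liftK.
Qed.

Lemma enorm_le_consv n (t : R) (v : 'rV[R]_n) : enorm v <= enorm (consv (t, v)).
Proof.
rewrite -(ler_pXn2r (_ : 0 < 2)%N) ?nnegrE ?enorm_ge0// sqr_enorm_consv.
by rewrite lerDr sqr_ge0.
Qed.

Lemma norm_le_consv n (t : R) (v : 'rV[R]_n) : `|t| <= enorm (consv (t, v)).
Proof.
rewrite -(ler_pXn2r (_ : 0 < 2)%N) ?nnegrE ?enorm_ge0// sqr_enorm_consv.
by rewrite real_normK ?num_real// lerDl sqr_ge0.
Qed.

Lemma consv_le n (t : R) (v : 'rV[R]_n) : enorm (consv (t, v)) <= `|t| + enorm v.
Proof.
rewrite -(ler_pXn2r (_ : 0 < 2)%N) ?nnegrE ?enorm_ge0//; last first.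
  by rewrite addr_ge0 ?enorm_ge0.
rewrite sqr_enorm_consv sqrrD real_normK ?num_real// -addrA lerD2l lerDr.
by rewrite mulrn_wge0// mulr_ge0// enorm_ge0.
Qed.
End euclid.

(** * Volumes of balls and invariance under rotations *)

Section ball.
Context {R : realType}.
Local Notation lam := (@lebesgue_measure R).

Definition cube n (r : R) : set 'rV[R]_n := [set x | forall i, `|x ord0 i| <= r].

Lemma cubeS n (r : R) :
  @consv R n @^-1` (@cube n.+1 r) = [set` `[- r, r]] `*` @cube n r.
Proof.
apply/seteqP; split => [[t v] /= H|[t v] [/=]].
  split => [|i]/=; first by have := H ord0; rewrite mxE unlift_none in_itv/= ler_norml.
  by have := H (lift ord0 i); rewrite mxE liftK.
rewrite in_itv/= -ler_norml => tr H i; rewrite mxE; by case: unliftP => [j _|_]/=.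
Qed.

Lemma measurable_cube n r : measurable (@cube n r).
Proof.
rewrite (_ : cube r = \bigcap_(i in [set: 'I_n])
    (fun x : 'rV[R]_n => x ord0 i) @^-1` [set` `[- r, r]]).
  apply: fin_bigcap_measurable => // i _.
  by rewrite -[X in measurable X]setTI; apply: measurable_coord.
apply/seteqP; split => x /= H i; last by rewrite ler_norml; have := H i I; rewrite /= in_itv.
by move=> _; rewrite /= in_itv/= -ler_norml.
Qed.

Lemma volume_cube n (r : R) : 0 < r ->
  lebesgue_rV n (@cube n r) = ((2 * r) ^+ n)%:E.
Proof.
move=> r0; elim: n => [|n IH].
  by rewrite expr0 /= diracE mem_set// => -[].
rewrite /= /pushforward cubeS.
transitivity (lam [set` `[- r, r]%R] * lebesgue_rV n (@cube n r))%E.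
  by apply: product_measure1E => //; exact: measurable_cube.
rewrite IH lebesgue_measure_itv/= lte_fin ifT; last lra.
by rewrite EFinN -EFinB -EFinM exprS; congr (_ * _)%:E; ring.
Qed.

Definition ballr n (r : R) : set 'rV[R]_n := [set x | enorm x <= r].

Lemma measurable_ballr n r : measurable (@ballr n r).
Proof.
rewrite (_ : ballr r = @enorm R n @^-1` [set` `]-oo, r]]).
  by rewrite -[X in measurable X]setTI; apply: measurable_enorm.
by apply/seteqP; split => x; rewrite /ballr/= in_itv.
Qed.

Lemma volume_unit_ball_fin n : lebesgue_rV n (unit_ball n) = (ball_volume n)%:E :> \bar R.
Proof.
rewrite /ball_volume fineK// ge0_fin_numE//.
apply: (@le_lt_trans _ _ (lebesgue_rV n (@cube n 1))).
  apply: le_measure; rewrite ?inE; [exact: measurable_unit_ball|exact: measurable_cube|].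
  by move=> x /= x1 i; exact: le_trans (coord_le_enorm _ _) x1.
by rewrite volume_cube// ltry.
Qed.

Lemma ball_volume_gt0 n : 0 < ball_volume n :> R.
Proof.
rewrite -lte_fin -volume_unit_ball_fin.
apply: (@lt_le_trans _ _ (lebesgue_rV n (@cube n n.+1%:R^-1))).
  by rewrite volume_cube ?invr_gt0// lte_fin exprn_gt0// mulr_gt0// invr_gt0.
apply: le_measure; rewrite ?inE; [exact: measurable_cube|exact: measurable_unit_ball|].
move=> x /sqr_enorm_le H; rewrite /unit_ball/=.
rewrite -(ler_pXn2r (_ : 0 < 2)%N) ?nnegrE ?enorm_ge0// expr1n.
apply: le_trans H _; rewrite exprVn ler_pdivrMr ?exprn_gt0// mul1r -natrX ler_nat.
by rewrite (leq_trans (leqnSn n))// leq_pmulr.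
Qed.

(** The constant is determined by the unit ball, which is mapped to itself and
    has finite positive volume. *)
Lemma orthogonal_scales_volume n (M : 'M[R]_n) : M *m M^T = 1%:M ->
  scales_volume (fun x : 'rV[R]_n => x *m M) 1.
Proof.
move=> MM; have [c c0 hc] := unitmx_scales_volume (proj1 (mulmx1_unit MM)).
suff -> : 1 = c by [].
have := hc _ (@measurable_unit_ball R n).
rewrite (_ : _ @^-1` _ = unit_ball n); last first.
  by apply/seteqP; split => x /=; rewrite /unit_ball/= enorm_mulmx.
rewrite volume_unit_ball_fin -EFinM => -[].
rewrite -[X in X = _ -> _]mul1r => /mulIf; apply.
by rewrite gt_eqF// ball_volume_gt0.
Qed.

Lemma volume_ballr n (r : R) : 0 < r ->
  lebesgue_rV n (@ballr n r) = (r ^+ n * ball_volume n)%:E.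
Proof.
move=> r0; have := scales_volume_dilation (n := n) r0 (@measurable_ballr n r).
rewrite (_ : _ @^-1` _ = unit_ball n); last first.
  by apply/seteqP; split => x /=; rewrite /unit_ball/ballr/= enormZ gtr0_norm// ger_pMr.
rewrite volume_unit_ball_fin EFinM => ->.
by rewrite muleA -EFinM mulfV ?mul1e// expf_neq0// gt_eqF.
Qed.
End ball.

(** * Integrals of powers *)

Section powers.
Context {R : realType}.
Local Notation lam := (@lebesgue_measure R).

Lemma is_derive_powR_div (p x : R) : 0 < p -> 0 < x ->
  is_derive x (1 : R) (fun t : R => p^-1 * t `^ p) (x `^ (p - 1)).
Proof.
move=> p0 x0; have xI : x \in `]0, +oo[ by rewrite in_itv/= x0.
have d1 : is_derive x (1 : R) (fun t : R => t `^ p) (p * x `^ (p - 1)).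
  apply: DeriveDef; first exact: derivable_powR.
  by rewrite -derive1E powR_derive1.
have := is_deriveZ (p^-1) d1; rewrite /GRing.scale/= mulrA mulVf ?mul1r ?gt_eqF//.
Qed.

Lemma integral_powR_itvcc (p a b : R) : 0 < p -> 0 < a -> a < b ->
  (\int[lam]_(t in `[a, b]) (t `^ (p - 1))%:E = (b `^ p / p - a `^ p / p)%:E)%E.
Proof.
move=> p0 a0 ab.
have cont x : 0 < x -> {for x, continuous (fun t : R => p^-1 * t `^ p)}.
  move=> x0; apply: differentiable_continuous; apply/derivable1_diffP.
  by have [] := is_derive_powR_div p0 x0.
have pos x : a <= x -> 0 < x by exact: lt_le_trans.
rewrite (@continuous_FTC2 _ _ (fun t => p^-1 * t `^ p))//.
- by rewrite -EFinB ![p^-1 * _]mulrC.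
- apply: derivable_within_continuous => x; rewrite in_itv/= => /andP[/pos x0 _].
  by apply: derivable_powR; rewrite in_itv/= x0.
- split => [x||].
  + rewrite in_itv/= => /andP[/ltW /pos x0 _].
    by have [] := is_derive_powR_div p0 x0.
  + exact/cvg_at_right_filter/cont.
  + by apply/cvg_at_left_filter/cont; rewrite (lt_trans a0).
- move=> x; rewrite in_itv/= => /andP[/ltW /pos x0 _].
  by rewrite derive1E; have [] := is_derive_powR_div p0 x0.
Qed.

(** The integrand may blow up at [0]: integrate from [b / (k + 2)] to [b] and
    let [k] grow. *)
Lemma integral_powR (p b : R) : 0 < p -> 0 < b ->
  (\int[lam]_(t in `]0%R, b]) (t `^ (p - 1))%:E = (b `^ p / p)%:E)%E.
Proof.
move=> p0 b0.
pose u (k : nat) : R := b * k.+2%:R^-1.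
have u0 k : 0 < u k by rewrite mulr_gt0// invr_gt0.
have ub k : u k < b by rewrite gtr_pMr// invf_lt1// ltr1n.
have cu : u k @[k --> \oo] --> (0 : R).
  rewrite -[0](mulr0 b); apply: cvgMr.
  by have := @cvg_harmonic R; rewrite -cvg_shiftS.
have -> : `]0%R, b]%classic = \bigcup_k `[u k, b]%classic.
  apply/seteqP; split => [t|t [k _]] /=; rewrite !in_itv/=; last first.
    by move=> /andP[kt ->]; rewrite (lt_le_trans (u0 k) kt).
  move=> /andP[t0 tb].
  have [k _ /(_ k (leqnn k)) uk] : \forall k \near \oo, u k < t.
    by move/cvgrPdist_lt : cu => /(_ _ t0); apply: filterS => k /=; rewrite sub0r normrN gtr0_norm.
  by exists k => //=; rewrite in_itv/= tb (ltW uk).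
have mpow : measurable_fun setT (fun t : R => (t `^ (p - 1))%:E).
  by apply/measurable_EFinP; exact: measurable_powR.
have H : (\int[lam]_(t in `[u k, b]) (t `^ (p - 1))%:E)%E @[k --> \oo] -->
    (\int[lam]_(t in \bigcup_k `[u k, b]%classic) (t `^ (p - 1))%:E)%E.
  apply: ge0_nondecreasing_set_cvg_integral => //.
  - apply/nondecreasing_seqP => k; rewrite subsetEset => x /=; rewrite !in_itv/=.
    move=> /andP[+ ->]; rewrite andbT; apply: le_trans.
    by rewrite ler_pM2l// lef_pV2 ?posrE// ler_nat.
  - by move=> k; apply: measurable_funS mpow.
  - by move=> k x _; rewrite lee_fin powR_ge0.
have H' : (\int[lam]_(t in `[u k, b]) (t `^ (p - 1))%:E)%E @[k --> \oo] -->
    (b `^ p / p)%:E.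
  under eq_fun do rewrite integral_powR_itvcc//.
  apply: cvg_EFin; first by near=> k.
  rewrite -[X in _ --> X]subr0 -[X in _ - X](mul0r p^-1).
  apply: cvgB; first exact: cvg_cst.
  apply: cvgMl; have /cvg_at_rightP := powR_cvg0 p0; apply; split => //.
by have := cvg_unique _ H H'; apply.
Unshelve. all: by end_near. Qed.

End powers.

(** * Moments of the ball *)

Section moments.
Context {R : realType}.
Local Notation lam := (@lebesgue_measure R).

Lemma volume_preserving_integral n (T : 'rV[R]_n -> 'rV[R]_n) D (f : 'rV[R]_n -> \bar R) :
  measurable_fun setT T -> scales_volume T 1 ->
  measurable D -> measurable_fun D f -> (forall x, D x -> (0 <= f x)%E) ->
  (\int[lebesgue_rV n]_(x in D) f x =
   \int[lebesgue_rV n]_(x in T @^-1` D) f (T x))%E.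
Proof.
move=> mT hT mD mf f0.
rewrite -(@ge0_integral_pushforward _ _ _ _ R T mT (lebesgue_rV n) D f mD mf); last first.
  by move=> x; rewrite inE => /f0.
by apply: eq_measure_integral => A mA _; rewrite /pushforward -[LHS]mul1e -hT.
Qed.

(** Layer cake: both sides are the volume of the set of [(t, v)] such that
    [0 < t < |v| <= a], sliced at fixed [v] and at fixed [t]. *)
Lemma integral_enorm_ballr n (a : R) : 0 < a ->
  (\int[lebesgue_rV n]_(v in @ballr R n a) (enorm v)%:E =
   (n%:R * a ^+ n.+1 * ball_volume n / n.+1%:R)%:E)%E.
Proof.
move=> a0.
pose A : set 'rV[R]_n.+1 := [set x | [/\ 0 < x ord0 ord0,
  x ord0 ord0 < enorm (\row_j x ord0 (lift ord0 j)) &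
  enorm (\row_j x ord0 (lift ord0 j)) <= a]].
have AE t v : A (consv (t, v)) <-> [/\ 0 < t, t < enorm v & enorm v <= a].
  rewrite /A/=; rewrite mxE unlift_none/=.
  rewrite (_ : \row_j _ = v) //; apply/rowP => j; by rewrite !mxE liftK.
have mA : measurable A.
  pose s := (fun x : 'rV[R]_n.+1 => x ord0 ord0).
  pose e := (fun x : 'rV[R]_n.+1 => enorm (\row_j x ord0 (lift ord0 j))).
  have ms : measurable_fun setT s by exact: measurable_coord.
  have me : measurable_fun setT e.
    apply: (measurableT_comp (@measurable_enorm R n)).
    apply: measurable_fun_rV => j.
    under [X in measurable_fun _ X]eq_fun do rewrite mxE.
    exact: measurable_coord.
  rewrite (_ : A = (s @^-1` `]0, +oo[) `&` ((fun x => e x - s x) @^-1` `]0, +oo[)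
     `&` (e @^-1` `]-oo, a])); last first.
    apply/seteqP; split => x /=; rewrite !in_itv/= !andbT subr_gt0.
      by move=> [].
    by move=> [[]].
  by do ?apply: measurableI; rewrite -[X in measurable X]setTI;
    [apply: ms|apply: measurable_funB|apply: me].
have H1 : lebesgue_rV n.+1 A = (\int[lebesgue_rV n]_(v in @ballr R n a) (enorm v)%:E)%E.
  rewrite lebesgue_rVSr// [RHS]integral_mkcond; apply: eq_integral => v _.
  rewrite patchE; case: ifPn => [|/negP]; rewrite inE => va.
    rewrite (_ : [set _ | _] = [set` `]0, enorm v[]).
      rewrite lebesgue_measure_itv/= lte_fin; case: ltP => [_|]; first by rewrite oppr0 adde0.
      by move=> ve; congr EFin; apply/eqP; rewrite eq_le ve enorm_ge0.
    apply/seteqP; split => t /=; rewrite in_itv/=.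
      by move=> /AE[-> ->].
    by move=> /andP[? ?]; apply/AE.
  rewrite (_ : [set _ | _] = set0) ?measure0//.
  by apply/seteqP; split => t //= /AE[].
rewrite -H1 lebesgue_rVS.
have -> : (\int[lam]_x lebesgue_rV n [set v | A (consv (x, v))] =
  \int[lam]_(t in `]0%R, a]) ((a ^+ n - t ^+ n) * ball_volume n)%:E)%E.
  rewrite [RHS]integral_mkcond; apply: eq_integral => t _.
  rewrite patchE; case: ifPn => [|/negP]; rewrite inE/= in_itv/=; last first.
    move=> /negP; rewrite negb_and -!leNgt -ltNge => H.
    rewrite (_ : [set _ | _] = set0) ?measure0//; apply/seteqP; split => v //= /AE[t0 tv va].
    by case/orP : H => ?; lra.
  move=> /andP[t0 ta].
  rewrite (_ : [set _ | _] = ballr a `\` ballr t); last first.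
    apply/seteqP; split => v /=; rewrite /ballr/=.
      by move=> /AE[_ tv ->]; split => //; apply/negP; rewrite -ltNge.
    by move=> [va /negP]; rewrite -ltNge => tv; apply/AE.
  transitivity (lebesgue_rV n (@ballr R n a) -
      lebesgue_rV n (@ballr R n a `&` @ballr R n t))%E.
    apply: measureD; [exact: measurable_ballr|exact: measurable_ballr|].
    by rewrite [ltLHS](volume_ballr n a0) ltry.
  rewrite setIidr => [|v]; last by rewrite /ballr/= => /le_trans; exact.
  by rewrite !volume_ballr// -EFinB -mulrBl.
have mX k : measurable_fun `]0, a] (fun t : R => (t ^+ k * ball_volume n)%:E).
  by apply/measurable_EFinP; apply: measurable_funM => //; exact: measurable_funX.
have X0 k : (\int[lam]_(t in `]0%R, a]) (t ^+ k * ball_volume n)%:E =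
   (a ^+ k.+1 / k.+1%:R * ball_volume n)%:E)%E.
  have := @integral_powR R k.+1%:R a (ltr0Sn _ _) a0.
  rewrite powR_mulrn ?ltW// => H; rewrite EFinM -H.
  rewrite -ge0_integralZr//; last by rewrite lee_fin ltW// ball_volume_gt0.
    apply: eq_integral => t; rewrite inE/= in_itv/= => /andP[t0 _].
    rewrite -EFinM; congr (_ * _)%:E; rewrite -natr1 addrK powR_mulrn// ltW//.
  - by apply: measurable_funTS; apply/measurable_EFinP; exact: measurable_powR.
  - by move=> x _; rewrite lee_fin powR_ge0.
have := X0 n.
have : (\int[lam]_(t in `]0%R, a]) (a ^+ n * ball_volume n)%:E =
   (a ^+ n.+1 * ball_volume n)%:E)%E.
  transitivity ((a ^+ n * ball_volume n)%:E * lam `]0%R, a]%classic)%E.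
    exact: integral_cst.
  rewrite lebesgue_measure_itv/= lte_fin a0 oppr0 adde0.
  by rewrite -EFinM; congr EFin; rewrite exprSr mulrAC.
have bv := ball_volume_gt0 (R := R) n.
have -> : (\int[lam]_(t in `]0%R, a]) (a ^+ n * ball_volume n)%:E =
  \int[lam]_(t in `]0%R, a]) ((a ^+ n - t ^+ n) * ball_volume n)%:E +
  \int[lam]_(t in `]0%R, a]) (t ^+ n * ball_volume n)%:E)%E.
  rewrite -ge0_integralD//.
  - by apply: eq_integral => t _; rewrite -EFinD -mulrDl subrK.
  - move=> t /=; rewrite in_itv/= => /andP[t0 ta]; rewrite lee_fin mulr_ge0 ?(ltW bv)//.
    by rewrite subr_ge0 lerXn2r ?nnegrE// ltW.
  - apply/measurable_EFinP; apply: measurable_funM => //; apply: measurable_funB => //.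
  - move=> t /=; rewrite in_itv/= => /andP[t0 ta]; rewrite lee_fin mulr_ge0 ?(ltW bv)//.
    by rewrite exprn_ge0// ltW.
  - exact: mX.
move=> Hc X; move: Hc; rewrite X; set I := (\int[_]_(_ in _) _)%E.
case: I => [r| |]//= [rE]; congr EFin.
have n0 : n%:R + 1 != 0 :> R by rewrite natr1.
have -> : r = a ^+ n.+1 * ball_volume n - a ^+ n.+1 / n.+1%:R * ball_volume n by rewrite -rE addrK.
by rewrite -natr1; field.
Qed.
End moments.

(** * Quadratic moments of the ball *)

Section quadratic_moments.
Context {R : realType}.

Lemma measurable_enormV n : measurable_fun [set: 'rV[R]_n] (fun v : 'rV[R]_n => (enorm v)^-1).
Proof.
rewrite (_ : (fun _ => _) = (fun a : R => a `^ (-1)) \o @enorm R n).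
  by apply: measurableT_comp; [exact: measurable_powR|exact: measurable_enorm].
by apply/funext => v /=; rewrite powR_inv1// enorm_ge0.
Qed.

Lemma perm_mx_orthogonal n (s : 'S_n) : perm_mx s *m (perm_mx s)^T = 1%:M :> 'M[R]_n.
Proof. by rewrite tr_perm_mx -perm_mxM mulgV perm_mx1. Qed.

(** Exchanging two coordinates is an orthogonal map, so the integral does not depend on
    [i]; the sum over [i] is the integral of [|v|]. *)
Lemma integral_sqr_coord_ballr n (a : R) (i : 'I_n) : 0 < a ->
  (\int[lebesgue_rV n]_(v in @ballr R n a) (v ord0 i ^+ 2 / enorm v)%:E =
   (a ^+ n.+1 * ball_volume n / n.+1%:R)%:E)%E.
Proof.
move=> a0.
have msq (j : 'I_n) : measurable_fun (@ballr R n a) (fun v : 'rV[R]_n => (v ord0 j ^+ 2 / enorm v)%:E).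
  apply: measurable_funTS; apply/measurable_EFinP; apply: measurable_funM.
    by apply: measurable_funX; exact: measurable_coord.
  exact: measurable_enormV.
have sq0 (j : 'I_n) (x : 'rV[R]_n) : (0 <= (x ord0 j ^+ 2 / enorm x)%:E)%E.
  by rewrite lee_fin mulr_ge0 ?sqr_ge0// invr_ge0 enorm_ge0.
pose I (j : 'I_n) := (\int[lebesgue_rV n]_(v in @ballr R n a) (v ord0 j ^+ 2 / enorm v)%:E)%E.
have Isym j : I j = I i.
  have MM := perm_mx_orthogonal (tperm i j).
  rewrite /I (volume_preserving_integral (measurable_mulmxr _) (orthogonal_scales_volume MM))//; last 1 first.
    exact: measurable_ballr.
  rewrite (_ : _ @^-1` _ = ballr a); last first.
    by apply/seteqP; split => x /=; rewrite /ballr/= enorm_mulmx.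
  apply: eq_integral => v _; rewrite enorm_mulmx//; congr (_ ^+ 2 / _)%:E.
  by rewrite -tpermV -col_permE mxE tpermR.
have : (\sum_(j < n) I j = (n%:R * a ^+ n.+1 * ball_volume n / n.+1%:R)%:E)%E.
  rewrite -integral_enorm_ballr// -ge0_integral_sum//; last exact: measurable_ballr.
  apply: eq_integral => v _; rewrite sumEFin; congr EFin.
  have [v0|v0] := eqVneq (enorm v) 0.
    by rewrite v0; apply: big1 => j _; rewrite invr0 mulr0.
  rewrite -mulr_suml; apply: (mulIf v0); rewrite mulfVK// -expr2 sqr_enorm.
  by apply: eq_bigr => j _; rewrite expr2.
under eq_bigr do rewrite Isym; rewrite /I.
have n0 : n%:R != 0 :> R by case: n i {a0 msq sq0 I Isym} => [[]|].
have n10 : n%:R + 1 != 0 :> R by rewrite natr1.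
set J := (\int[_]_(_ in _) _)%E.
have J0 : (0 <= J)%E by apply: integral_ge0 => v _.
case: J J0 => [r| |]//= _; last first.
  by rewrite (bigD1 i)//= addye// -ltNye (lt_le_trans (ltNyr 0%R))// sume_ge0.
rewrite sumEFin sumr_const card_ord -[r *+ n]mulr_natl => -[] H; congr EFin; apply: (mulfI n0); rewrite H.
by rewrite -natr1; field.
Qed.

(** When [kappa] lists the principal curvatures, this is the quadratic part of
    the function whose graph is the boundary. *)
Definition half_form n (kappa v : 'rV[R]_n) : R :=
  2^-1 * \sum_i kappa ord0 i * v ord0 i ^+ 2.

Lemma measurable_half_form n (kappa : 'rV[R]_n) :
  measurable_fun setT (half_form kappa).
Proof.
apply: measurable_funM => //; apply: measurable_sum => i.
apply: measurable_funM => //; apply: measurable_funX; exact: measurable_coord.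
Qed.

Lemma half_formZ n (kappa v : 'rV[R]_n) a : half_form kappa (a *: v) = a ^+ 2 * half_form kappa v.
Proof.
rewrite /half_form mulrCA; congr (_ * _); rewrite mulr_sumr; apply: eq_bigr => i _.
by rewrite mxE exprMn mulrCA.
Qed.

Lemma half_form_ge0 n (kappa v : 'rV[R]_n) : (forall i, 0 <= kappa ord0 i) ->
  0 <= half_form kappa v.
Proof.
by move=> k0; rewrite mulr_ge0// sumr_ge0// => i _; rewrite mulr_ge0// sqr_ge0.
Qed.

Lemma half_form_le n (kappa v : 'rV[R]_n) : (forall i, 0 <= kappa ord0 i) ->
  half_form kappa v <= (\sum_i kappa ord0 i) * enorm v ^+ 2.
Proof.
move=> k0; rewrite /half_form.
have H : \sum_i kappa ord0 i * v ord0 i ^+ 2 <= (\sum_i kappa ord0 i) * enorm v ^+ 2.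
  rewrite mulr_suml ler_sum// => i _; rewrite ler_wpM2l//.
  by rewrite -real_normK ?num_real// lerXn2r ?nnegrE ?enorm_ge0// coord_le_enorm.
have : 0 <= \sum_i kappa ord0 i * v ord0 i ^+ 2.
  by rewrite sumr_ge0// => i _; rewrite mulr_ge0// sqr_ge0.
by move: H; lra.
Qed.

Lemma integral_half_form_ballr n (kappa : 'rV[R]_n) (a : R) : 0 < a ->
  (forall i, 0 <= kappa ord0 i) ->
  (\int[lebesgue_rV n]_(v in @ballr R n a) (half_form kappa v / enorm v)%:E =
   (2^-1 * (\sum_i kappa ord0 i) * (a ^+ n.+1 * ball_volume n / n.+1%:R))%:E)%E.
Proof.
move=> a0 k0.
rewrite (eq_integral (fun v : 'rV[R]_n => \sum_(i < n) ((2^-1 * kappa ord0 i)%:E * (v ord0 i ^+ 2 / enorm v)%:E))%E); last first.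
  move=> v _; rewrite sumEFin; congr EFin; rewrite /half_form mulr_sumr mulr_suml.
  by apply: eq_bigr => i _; rewrite !mulrA.
have msq (j : 'I_n) : measurable_fun (@ballr R n a) (fun v : 'rV[R]_n => (v ord0 j ^+ 2 / enorm v)%:E).
  apply: measurable_funTS; apply/measurable_EFinP; apply: measurable_funM.
    by apply: measurable_funX; exact: measurable_coord.
  exact: measurable_enormV.
have sq0 (j : 'I_n) (x : 'rV[R]_n) : (0 <= (x ord0 j ^+ 2 / enorm x)%:E)%E.
  by rewrite lee_fin mulr_ge0 ?sqr_ge0// invr_ge0 enorm_ge0.
have hk i : 0 <= 2^-1 * kappa ord0 i by rewrite mulr_ge0.
rewrite ge0_integral_sum//; [|exact: measurable_ballr| |]; last 2 first.
- by move=> i; apply: measurable_funeM.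
- by move=> i v _; rewrite mule_ge0// lee_fin.
rewrite (eq_bigr (fun i => (2^-1 * kappa ord0 i * (a ^+ n.+1 * ball_volume n / n.+1%:R))%:E)); last first.
  move=> i _; rewrite ge0_integralZl_EFin//; last exact: measurable_ballr.
  by rewrite integral_sqr_coord_ballr// -EFinM.
by rewrite sumEFin -mulr_suml -mulr_sumr.
Qed.
End quadratic_moments.

(** * Convex bodies and radial functions *)

Section convexity.
Context {R : realType} {n : nat}.
Implicit Types (K : set 'rV[R]_n) (x y z u : 'rV[R]_n).

Lemma convex_setP K : convex_set K -> forall x y s, K x -> K y -> 0 <= s <= 1 ->
  K (s *: x + (1 - s) *: y).
Proof.
move=> cK x y s Kx Ky /andP[s0 s1].
by have := cK x y (Itv01 s0 s1); rewrite !inE; apply.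
Qed.

Lemma interior_ball K x : (K° x) <-> exists2 e, 0 < e & forall y, `|x - y| < e -> K y.
Proof.
split=> [|[e e0 xe]].
  by rewrite /interior/= => /nbhs_normP[e e0 xe]; exists e => // y; exact: xe.
by apply/(nbhs_normP x K); exists e => // y; exact: xe.
Qed.

(** The homothety of centre [y] and ratio [s] maps a ball around [x] contained in
    [K] to a ball around the new point. *)
Lemma convex_interior K x y s : convex_set K -> K° x -> K y -> 0 < s <= 1 ->
  K° (s *: x + (1 - s) *: y).
Proof.
move=> cK /interior_ball[e e0 xe] Ky /andP[s0 s1]; apply/interior_ball.
exists (s * e); first exact: mulr_gt0.
move=> w; set v := s *: x + (1 - s) *: y => wv.
have -> : w = s *: (x + s^-1 *: (w - v)) + (1 - s) *: y.
  rewrite scalerDr scalerA mulfV ?gt_eqF// scale1r addrAC.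
  by rewrite -/v [v + _]addrC subrK.
apply: convex_setP => //; last by rewrite ltW.
apply: xe; rewrite opprD addrA subrr sub0r normrN normrZ gtr0_norm ?invr_gt0//.
by rewrite mulrC ltr_pdivrMr// distrC mulrC.
Qed.

Section radial.
Variables (K : set 'rV[R]_n) (z u : 'rV[R]_n).
Hypotheses (cK : compact K) (vK : convex_set K) (Kz : K z) (u0 : u != 0).
Let S := [set l : R | K (z + l *: u)].
Local Notation rho := (radial_function K z u).

Let S0 : S 0. Proof. by rewrite /S/= scale0r addr0. Qed.

Let S_has_sup : has_sup S.
Proof.
split; first by exists 0.
have [M [_ /(_ (M + 1))]] := compact_bounded cK.
rewrite ltrDl => /(_ ltr01) KM.
exists ((M + 1 + `|z|) / `|u|) => l /KM lM.
rewrite ler_pdivlMr ?normr_gt0// (le_trans (ler_norm _))// normrM normr_id -normrZ.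
rewrite -[l *: u](addKr z) addrC (le_trans (ler_normB _ _))// lerD2r//.
Qed.

Let S_closed : closed S.
Proof.
rewrite (_ : S = (fun l : R => z + l *: u) @^-1` K)//.
apply: preimage_closed; last exact: compact_closed.
move=> l _; apply: cvgD; first exact: cvg_cst.
by apply: cvgZr_tmp; exact: cvg_id.
Qed.

(** The set of parameters of the ray staying in [K] is closed and bounded, so it
    contains its supremum. *)
Lemma radial_function_mem : K (z + rho *: u).
Proof.
have := closure_sup (proj1 S_has_sup) (proj2 S_has_sup).
by rewrite -(closure_id S).1.
Qed.

Lemma radial_function_max l : K (z + l *: u) -> l <= rho.
Proof. by move=> Kl; apply: sup_upper_bound. Qed.

Lemma radial_function_ge0 : 0 <= rho.
Proof. exact: (radial_function_max S0). Qed.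

Lemma radial_function_segment l : 0 <= l <= rho -> K (z + l *: u).
Proof.
move=> /andP[]; rewrite le_eqVlt => /predU1P[<- _|l0 lr]; first exact: S0.
have r0 : 0 < rho by exact: lt_le_trans lr.
have := @convex_setP K vK (z + rho *: u) z (l / rho) radial_function_mem Kz.
rewrite ler_pdivrMr// mul1r lr divr_ge0 ?ltW// => /(_ erefl).
rewrite scalerDr scalerA mulfVK ?gt_eqF// addrAC -scalerDl [_ / _ + _]addrC subrK.
by rewrite scale1r.
Qed.

Lemma radial_function_not_interior : ~ K° (z + rho *: u).
Proof.
move=> /interior_ball[e e0 He].
have un : 0 < `|u| by rewrite normr_gt0.
pose d := e / 2 / `|u|.
have d0 : 0 < d by rewrite !divr_gt0.
have : K (z + (rho + d) *: u).
  apply: He; rewrite scalerDl addrA opprD addrA subrr sub0r normrN normrZ gtr0_norm//.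
  by rewrite /d mulfVK ?gt_eqF// ltr_pdivrMr// ltr_pMr// ltr1n.
by move/radial_function_max; rewrite gerDl leNgt d0.
Qed.
End radial.

End convexity.

(** * Adapted orthonormal frames *)

Section frames.
Context {R : realType}.

(** The topology on row vectors is that of the sup norm, so smallness has to be
    transferred between the two norms. *)
Lemma enorm_le_mxnorm n (x : 'rV[R]_n) : enorm x <= n%:R * `|x|.
Proof.
rewrite -(ler_pXn2r (_ : 0 < 2)%N) ?nnegrE ?enorm_ge0 ?mulr_ge0//.
rewrite (le_trans (sqr_enorm_le (coord_le_mxnorm x)))// exprMn ler_wpM2r ?sqr_ge0//.
by rewrite -natrX ler_nat -mulnn; case: n {x} => // n; rewrite leq_pmulr.
Qed.

Lemma half_form_norm_le n (kappa v : 'rV[R]_n) :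
  `|half_form kappa v| <= (\sum_i `|kappa ord0 i|) * enorm v ^+ 2.
Proof.
rewrite /half_form normrM ger0_norm ?invr_ge0// mulr_suml.
set S := \sum_(i < _) _.
have H : `|S| <= \sum_(i < n) `|kappa ord0 i| * enorm v ^+ 2.
  rewrite (le_trans (ler_norm_sum _ _ _))// ler_sum// => i _.
  rewrite normrM ler_wpM2l// normrX lerXn2r ?nnegrE ?enorm_ge0//.
  exact: coord_le_enorm.
by rewrite (le_trans _ H)// ler_piMl// invf_le1// ler1n.
Qed.

(** The first row is the inner normal, so that the first of the coordinates [x]
    of [x *m frame e E] is the height above the tangent hyperplane. *)
Definition frame m (e : 'rV[R]_m.+1) (E : 'M[R]_(m, m.+1)) : 'M[R]_(m.+1) :=
  col_mx e E : 'M[R]_(1 + m, m.+1).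

Lemma frame_orthogonal m (e : 'rV[R]_m.+1) (E : 'M[R]_(m, m.+1)) :
  enorm e = 1 -> E *m E^T = 1%:M -> e *m E^T = 0 ->
  frame e E *m (frame e E)^T = 1%:M.
Proof.
move=> e1 EE eE; rewrite /frame (@tr_col_mx _ 1 m) (@mul_col_row _ 1 m _ 1 m) EE eE.
have -> : e *m e^T = 1%:M by rewrite [LHS]mx11_scalar -dotvE -sqr_enorm e1 expr1n.
have -> : E *m e^T = 0 by rewrite -[LHS]trmxK trmx_mul trmxK eE trmx0.
by rewrite -scalar_mx_block.
Qed.

Lemma mul_frame_tr m (e : 'rV[R]_m.+1) (E : 'M[R]_(m, m.+1)) w :
  w *m (frame e E)^T = consv (dotv w e, w *m E^T).
Proof.
rewrite /frame (@tr_col_mx _ 1 m) (@mul_mx_row _ 1 _ 1 m) consv_row_mx.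
by rewrite [w *m e^T]mx11_scalar -dotvE.
Qed.

Lemma consv_inj m : injective (@consv R m).
Proof.
move=> [t v] [t' v'] /rowP H; congr pair.
  by have := H ord0; rewrite !mxE unlift_none.
by apply/rowP => i; have := H (lift ord0 i); rewrite !mxE liftK.
Qed.

Lemma mxnorm_consv m t (v : 'rV[R]_m) r : `|t| <= r -> `|v| <= r -> `|consv (t, v)| <= r.
Proof.
move=> tr vr; rewrite [leLHS]/Num.norm/= mx_normrE; apply: bigmax_le.
  by rewrite (le_trans _ tr).
move=> [i j] _ /=; rewrite mxE; case: unliftP => [k _|_] //=.
by rewrite (le_trans (coord_le_mxnorm _ _)).
Qed.

Lemma consvD m (t t' : R) (v v' : 'rV[R]_m) : consv (t, v) + consv (t', v') = consv (t + t', v + v').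
Proof. by apply/rowP => i; rewrite !mxE; case: unliftP => [j _|_]; rewrite ?mxE. Qed.

Lemma consvZ m (a t : R) (v : 'rV[R]_m) : a *: consv (t, v) = consv (a * t, a *: v).
Proof. by apply/rowP => i; rewrite !mxE; case: unliftP => [j _|_]; rewrite ?mxE. Qed.
End frames.

(** * Second order behaviour of the radial function *)

Section graph.
Context {R : realType} {m : nat}.
Variables (K : set 'rV[R]_m.+1) (z nu : 'rV[R]_m.+1) (E : 'M[R]_(m, m.+1)).
Variables (f : 'rV[R]_m -> R) (U : set 'rV[R]_m) (kappa : 'rV[R]_m).
Hypotheses (cK : compact K) (vK : convex_set K) (iK : K° !=set0) (Kz : K z).
Hypotheses (nu1 : enorm nu = 1) (nuK : forall y, K y -> dotv (y - z) nu <= 0).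
Hypotheses (EE : E *m E^T = 1%:M) (nuE : nu *m E^T = 0).
Hypotheses (U0 : nbhs (0 : 'rV[R]_m) U) (vf : convex_function U f).
Hypothesis bK : \forall y \near z,
  boundary K y <-> dotv (y - z) (- nu) = f ((y - z) *m E^T).
Hypothesis fo : (fun y => f y - 2^-1 * \sum_i kappa ord0 i * y ord0 i ^+ 2 : R^o)
          =o_ (0 : 'rV[R]_m) (fun y => enorm y ^+ 2 : R^o).

Let O := frame (- nu) E.
Let pt (x : 'rV[R]_m.+1) := z + x *m O.

Let nu1' : enorm (- nu) = 1.
Proof. by rewrite -scaleN1r enormZ normrN normr1 mul1r. Qed.

Lemma frame_nu_orthogonal : O *m O^T = 1%:M.
Proof. by apply: frame_orthogonal => //; rewrite mulNmx nuE oppr0. Qed.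
Let OO := frame_nu_orthogonal.

Let ptK y : pt ((y - z) *m O^T) = y.
Proof. by rewrite /pt -mulmxA (mulmx1C OO) mulmx1 addrC subrK. Qed.

Let pt_coord b a : dotv (pt (consv (b, a)) - z) (- nu) = b /\
  (pt (consv (b, a)) - z) *m E^T = a.
Proof.
have : (pt (consv (b, a)) - z) *m O^T = consv (b, a).
  by rewrite /pt addrAC subrr add0r -mulmxA OO mulmx1.
by rewrite mul_frame_tr => /consv_inj[].
Qed.

Lemma graph_expansion e : 0 < e -> exists2 d, 0 < d &
  forall a, `|a| < d -> `|f a - half_form kappa a| <= e * enorm a ^+ 2.
Proof.
move=> e0; have /eqoP /(_ _ e0) /nbhs_normP[d d0 H] := fo.
exists d => // a ad; have := H a; rewrite /= sub0r normrN => /(_ ad).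
by rewrite [X in _ <= _ * X]ger0_norm ?sqr_ge0.
Qed.

Let C : R := (\sum_i `|kappa ord0 i| + 1) * m%:R ^+ 2.

Let graph_le : exists2 d, 0 < d &
  forall a, `|a| < d -> `|f a| <= C * `|a| ^+ 2.
Proof.
have [d d0 H] := graph_expansion ltr01; exists d => // a /H; rewrite mul1r => ad.
have k := half_form_norm_le kappa a.
have : `|f a| <= (\sum_i `|kappa ord0 i| + 1) * enorm a ^+ 2.
  rewrite mulrDl mul1r -[f a](subrK (half_form kappa a)).
  by rewrite (le_trans (ler_normD _ _))// addrC lerD.
move=> /le_trans; apply; rewrite /C -mulrA -exprMn ler_wpM2l//.
  by rewrite addr_ge0// sumr_ge0.
by rewrite lerXn2r ?nnegrE ?enorm_ge0 ?mulr_ge0// enorm_le_mxnorm.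
Qed.

Let good d := [/\ 0 < d, forall a, `|a| < d -> U a,
  (forall b a, `|b| < d -> `|a| < d -> boundary K (pt (consv (b, a))) <-> b = f a) &
  (forall a, `|a| < d -> `|f a| <= C * `|a| ^+ 2)].

Let good_ex : exists d, good d.
Proof.
have [d1 d10 H1] := graph_le.
have /nbhs_normP[d2 d20 H2] := U0.
have /nbhs_normP[d3 d30 H3] := bK.
pose d := Num.min d1 (Num.min d2 (d3 / m.+1%:R)).
have d0 : 0 < d by rewrite !lt_min d10 d20 divr_gt0.
exists d; split => //.
- by move=> a; rewrite !lt_min => /and3P[_ ad _]; apply: H2; rewrite /= sub0r normrN.
- move=> b a bd ad; have [pb pa] := pt_coord b a.
  have := H3 (pt (consv (b, a))); rewrite /= pb pa; apply; rewrite /pt opprD addrA subrr sub0r normrN.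
  rewrite (le_lt_trans (mxnorm_le_enorm _))// enorm_mulmx//.
  rewrite (le_lt_trans (enorm_le_mxnorm _))// -ltr_pdivlMl//.
  rewrite [_^-1 * _]mulrC.
  apply: (@le_lt_trans _ _ (Num.max `|b| `|a|)).
    by apply: mxnorm_consv; rewrite le_max lexx ?orbT.
  by move: bd ad; rewrite gt_max !lt_min => /and3P[_ _ ->] /and3P[_ _ ->].
- by move=> a; rewrite lt_min => /andP[/H1].
Qed.

Let boundary_sub y : boundary K y -> K y.
Proof. by move=> [+ _]; rewrite -(closure_id K).1//; exact: compact_closed. Qed.

(** The inequality is strict because a small step along [nu] stays in [K]. *)
Let interior_above p : K° p -> 0 < dotv (p - z) (- nu).
Proof.
move=> /interior_ball[e e0 H].
have : K (p + (e / 2) *: nu).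
  apply: H; rewrite opprD addrA subrr sub0r normrN normrZ ger0_norm ?divr_ge0 ?ltW//.
  apply: (@le_lt_trans _ _ (e / 2)); last by rewrite ltr_pdivrMr// ltr_pMr// ltr1n.
  by rewrite ler_piMr ?divr_ge0 ?(ltW e0)// (le_trans (mxnorm_le_enorm nu))// nu1.
move/nuK; rewrite addrAC (dotvDl (p - z)) (dotvZl (e / 2)) -[dotv nu nu]sqr_enorm nu1 expr1n mulr1 dotvNr.
have : 0 < e / 2 by rewrite divr_gt0.
by lra.
Qed.

(** On the segment from [z] to an interior point the height is linear in the
   parameter [s], while [f] below it is [O(s^2)]. *)
Let interior_near d : good d -> forall r, 0 < r -> exists b a,
  [/\ `|b| < r, `|a| < r, f a < b & K° (pt (consv (b, a)))].
Proof.
move=> [d0 _ _ Hf] r r0; have [p Kp] := iK.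
have b0 := interior_above Kp.
set b := dotv (p - z) (- nu) in b0.
pose a := (p - z) *m E^T.
have pE : p = pt (consv (b, a)) by rewrite -[LHS]ptK mul_frame_tr.
have C0 : 0 <= C by rewrite mulr_ge0 ?sqr_ge0// addr_ge0// sumr_ge0.
pose N := 1 + b + `|a| + C * `|a| ^+ 2 / b.
have Ca : 0 <= C * `|a| ^+ 2 / b.
  by rewrite divr_ge0 ?(ltW b0)// mulr_ge0// sqr_ge0.
have N0 : 0 < N by rewrite /N; have := normr_ge0 a; lra.
(* [N] dominates every quantity to be made small by the factor [s]. *)
pose s := Num.min 1 (Num.min d r) / (2 * N).
have s0 : 0 < s by rewrite divr_gt0 ?mulr_gt0// !lt_min ltr01 d0 r0.
have sN : s * N = Num.min 1 (Num.min d r) / 2.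
  by rewrite /s invfM mulrA mulfVK ?gt_eqF.
have sN1 : s * N < 1.
  rewrite sN ltr_pdivrMr// mul1r (@le_lt_trans _ _ 1)// ?ltr1n//.
  by rewrite ge_min lexx.
have mdr : s * N < Num.min d r.
  rewrite sN ltr_pdivrMr// (@le_lt_trans _ _ (Num.min d r))//; first by rewrite ge_min lexx orbT.
  by rewrite ltr_pMr ?ltr1n// lt_min d0 r0.
have sa : s * `|a| <= s * N by rewrite ler_pM2l// /N; lra.
have sb : s * b <= s * N by rewrite ler_pM2l// /N; have := normr_ge0 a; lra.
have s1 : s <= 1.
  apply: (le_trans _ (ltW sN1)); rewrite ler_peMr ?(ltW s0)// /N.
  by have := normr_ge0 a; lra.
have sad : `|s *: a| < Num.min d r by rewrite normrZ gtr0_norm// (le_lt_trans sa).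
exists (s * b), (s *: a); split.
- rewrite gtr0_norm; last exact: mulr_gt0. rewrite (le_lt_trans sb)// (lt_le_trans mdr)// ge_min lexx orbT //.
- by apply: (lt_le_trans sad); rewrite ge_min lexx orbT.
- have /Hf : `|s *: a| < d by apply: (lt_le_trans sad); rewrite ge_min lexx.
  move=> /(le_trans (ler_norm _)) /le_lt_trans; apply.
  rewrite normrZ (gtr0_norm s0) exprMn.
  have : s * (C * `|a| ^+ 2 / b) < 1.
    by rewrite (le_lt_trans _ sN1)// ler_pM2l// /N; have := normr_ge0 a; lra.
  by rewrite mulrA ltr_pdivrMr// mul1r -(ltr_pM2l s0); lra.
- have -> : pt (consv (s * b, s *: a)) = s *: p + (1 - s) *: z.
    rewrite pE /pt -consvZ -scalemxAl scalerDr scalerBl scale1r.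
    by rewrite [RHS]addrC addrA subrK.
  by apply: convex_interior => //; rewrite s0.
Qed.

Let pt_conv s b a b' a' : s *: pt (consv (b, a)) + (1 - s) *: pt (consv (b', a')) =
  pt (consv (s * b + (1 - s) * b', s *: a + (1 - s) *: a')).
Proof.
rewrite /pt -consvD -!consvZ mulmxDl -!scalemxAl !scalerDr addrACA; congr (_ + _).
by rewrite -scalerDl addrC subrK scale1r.
Qed.

Let norm_conv (V : normedModType R) (x y : V) s r : 0 <= s <= 1 -> `|x| < r -> `|y| < r ->
  `|s *: x + (1 - s) *: y| < r.
Proof.
move=> /andP[s0 s1] xr yr; rewrite (le_lt_trans (ler_normD _ _))// !normrZ.
have s1' : 0 <= 1 - s by rewrite subr_ge0.
rewrite !ger0_norm//.
have [->|sn0] := eqVneq s 0; first by rewrite mul0r add0r subr0 mul1r.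
have H1 : s * `|x| < s * r by rewrite ltr_pM2l// lt_def sn0.
have H2 : (1 - s) * `|y| <= (1 - s) * r by rewrite ler_wpM2l// ltW.
by lra.
Qed.

(** As [f] is convex, the segment to an interior point above the graph stays
   above the graph, so it cannot cross the boundary. *)
Let above_interior d : good d -> forall b a, `|b| < d -> `|a| < d -> f a < b ->
  K° (pt (consv (b, a))).
Proof.
move=> gd b a bd ad fab; have [d0 dU dB _] := gd.
set y := pt _.
suff Ky : K y.
  apply: contrapT => nKy.
  have /(dB _ _ bd ad) : boundary K y by split => //; apply: subset_closure.
  by move=> /eqP; rewrite gt_eqF.
apply: contrapT => nKy.
have [b' [a' [b'd a'd fab' Kp]]] := interior_near gd d0.
set p := pt _ in Kp.
have Kp' : K p by exact: interior_subset.
have u0 : y - p != 0 by apply: contra_not_neq nKy => /eqP; rewrite subr_eq0 => /eqP ->.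
pose rho := radial_function K p (y - p).
have r0 : 0 <= rho := radial_function_ge0 cK Kp' u0.
have r1 : rho < 1.
  rewrite ltNge; apply/negP => r1; apply: nKy.
  have := @radial_function_segment _ _ K p (y - p) cK vK Kp' u0 1.
  by rewrite scale1r ler01 r1 addrC subrK; apply.
have wE : p + rho *: (y - p) = rho *: y + (1 - rho) *: p.
  by rewrite scalerBr scalerBl scale1r addrCA.
have r01 : 0 <= rho <= 1 by rewrite r0 ltW.
have : boundary K (p + rho *: (y - p)).
  split; first by apply: subset_closure; exact: radial_function_mem.
  exact: radial_function_not_interior.
rewrite wE pt_conv => /dB.
move=> /(_ (norm_conv (V := R^o) r01 bd b'd) (norm_conv r01 ad a'd)) H.
have := @vf (Itv01 r0 (ltW r1)) a a'; rewrite !inE => /(_ (dU _ ad) (dU _ a'd)).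
rewrite convRE /conv/= -H => {}H.
have : 0 < 1 - rho by rewrite subr_gt0.
have : rho * f a <= rho * b by rewrite ler_wpM2l// ltW.
move: H fab'; rewrite -subr_gt0 => H fab' + r1'.
have := mulr_gt0 r1' fab'. move: H; rewrite /unstable.onem; lra.
Qed.

(** Otherwise the graph point above would lie strictly between a point of [K] and
   an interior one, hence be interior. *)
Let below_outside d : good d -> exists2 d', 0 < d' & forall b a, `|b| < d' -> `|a| < d' -> b < f a ->
  ~ K (pt (consv (b, a))).
Proof.
move=> gd; have [d0 dU dB Hf] := gd.
have C0 : 0 <= C by rewrite mulr_ge0 ?sqr_ge0// addr_ge0// sumr_ge0.
pose d' := Num.min 1 (d / (2 * (C + 1))).
have d'0 : 0 < d' by rewrite lt_min ltr01 divr_gt0// mulr_gt0// ltr_wpDl.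
have d'd : (C + 1) * d' <= d / 2.
  rewrite -ler_pdivlMl ?ltr_wpDl// ge_min; apply/orP; right.
  suff -> : d / (2 * (C + 1)) = (C + 1)^-1 * (d / 2) by [].
  by field; rewrite gt_eqF// ltr_wpDl.
have Cd : 0 <= C * d' by rewrite mulr_ge0// ltW.
exists d' => // b a bd ad bf Kb.
have ad' : `|a| < d by move: d'd ad d0; lra.
have fad : `|f a| <= C * d'.
  rewrite (le_trans (Hf _ ad'))// ler_wpM2l//.
  have : `|a| <= 1 by rewrite (le_trans (ltW ad))// ge_min lexx.
  have := normr_ge0 a; move: ad; nra.
have fb1 : `|f a| < d by move: d'd d'0 fad d0; lra.
have fb2 : `|f a + d'| < d.
  rewrite (le_lt_trans (ler_normD _ _))// [`|d'|]gtr0_norm//.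
  by move: d'd d'0 fad d0; lra.
have Kt : K° (pt (consv (f a + d', a))) by apply: (above_interior gd) => //; rewrite ltrDl.
have [_ +] : boundary K (pt (consv (f a, a))) by apply/dB.
apply.
pose s := (f a - b) / (f a + d' - b).
have den : 0 < f a + d' - b by move: bf d'0; lra.
have s0 : 0 < s by rewrite divr_gt0// subr_gt0.
have s1 : s <= 1 by rewrite ler_pdivrMr//; move: d'0; lra.
have := @convex_interior _ _ K _ _ s vK Kt Kb.
rewrite s0 s1 => /(_ erefl); rewrite pt_conv -scalerDl [s + (1 - s)]addrC subrK scale1r.
congr (K° (pt (consv (_, a)))).
by rewrite /s; field; rewrite gt_eqF.
Qed.

(** This identifies [K] near [z] with the epigraph of [f], although only the
    boundary of [K] is assumed to be a graph. *)
Lemma graph_local : exists2 d, 0 < d & forall b a, `|b| < d -> `|a| < d ->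
  (f a < b -> K (pt (consv (b, a)))) /\ (b < f a -> ~ K (pt (consv (b, a)))).
Proof.
have [d gd] := good_ex; have [d' d'0 H] := below_outside gd.
have [d0 _ _ _] := gd.
exists (Num.min d d'); first by rewrite lt_min d0.
move=> b a; rewrite !lt_min => /andP[bd bd'] /andP[ad ad']; split; last exact: H.
by move=> /(above_interior gd bd ad) /interior_subset.
Qed.

(** Since [K] lies on one side of its tangent hyperplane, [f] is nonnegative
    near [0]; its expansion in the direction of the [i]-th axis would be negative
    for a negative curvature. *)
Lemma principal_curvature_ge0 i : 0 <= kappa ord0 i.
Proof.
have [d [d0 dU dB Hf]] := good_ex.
have C0 : 0 <= C by rewrite mulr_ge0 ?sqr_ge0// addr_ge0// sumr_ge0.
have f0 a : `|a| < d -> `|f a| < d -> 0 <= f a.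
  move=> ad fd; have : boundary K (pt (consv (f a, a))) by apply/dB.
  move=> /boundary_sub /nuK; have [] := pt_coord (f a) a.
  by rewrite dotvNr => H _; lra.
rewrite leNgt; apply/negP => k0.
have [d1 d10 H] := @graph_expansion (- kappa ord0 i / 4) (ltac:(by rewrite divr_gt0// oppr_gt0)).
pose s := Num.min 1 (Num.min d (Num.min d1 (d / (C + 1)))) / 2.
have M0 : 0 < Num.min 1 (Num.min d (Num.min d1 (d / (C + 1)))).
  by rewrite !lt_min ltr01 d0 d10 divr_gt0// ltr_wpDl.
have s0 : 0 < s by rewrite divr_gt0.
have : s < Num.min 1 (Num.min d (Num.min d1 (d / (C + 1)))) by rewrite ltr_pdivrMr// ltr_pMr// ltr1n.
rewrite !lt_min => /and4P[s1 sd sd1]; rewrite ltr_pdivlMr ?ltr_wpDl// => sC.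
pose a : 'rV[R]_m := s *: delta_mx ord0 i.
have ea : enorm a = s.
  rewrite /a enormZ gtr0_norm// /enorm /dotv (bigD1 i)//= big1 ?addr0.
    by rewrite !mxE !eqxx mulr1 sqrtr1 mulr1.
  by move=> j ji; rewrite !mxE (negbTE ji) andbF mulr0.
have as_ : `|a| <= s by rewrite -ea mxnorm_le_enorm.
have ka : half_form kappa a = s ^+ 2 * (kappa ord0 i / 2).
  rewrite /a half_formZ; congr (_ * _); rewrite /half_form mulrC; congr (_ / _).
  rewrite (bigD1 i)//= big1 ?addr0 => [|j ji]; rewrite !mxE; first by rewrite !eqxx expr1n mulr1.
  by rewrite (negbTE ji) andbF expr0n mulr0.
have ad : `|a| < d by exact: le_lt_trans sd.
have fd : `|f a| < d.
  rewrite (le_lt_trans (Hf _ ad))// (le_lt_trans _ sC)//.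
  have a2 : `|a| ^+ 2 <= s.
    have := normr_ge0 a; move: as_ s1; nra.
  by have := ler_wpM2l C0 a2; move: s0; lra.
have := H _ (le_lt_trans as_ sd1); rewrite ea ka => /(le_trans (ler_norm _)).
have := f0 _ ad fd.
have : 0 < s ^+ 2 by rewrite exprn_gt0.
by move: k0; nra.
Qed.

(** A point at distance [l] on the ray is in [K] or not according to the
    comparison of [l t] with [f (l v)], itself within [e l^2 |v|^2] of
    [l^2 k(v)]. The threshold [d] records up to which distance this is known:
    beyond it nothing is claimed about the radial function, which is why it
    appears through a minimum in the last bound. *)
Lemma radial_function_bounds e : 0 < e -> exists2 d, 0 < d < 1 &
  forall t v, 0 < t -> enorm (consv (t, v)) = 1 ->
  let rho := radial_function K z (consv (t, v) *m O) in
  [/\ 0 < rho, rho < d -> t <= rho * (half_form kappa v + e * enorm v ^+ 2) &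
      Num.min rho d * (half_form kappa v - e * enorm v ^+ 2) <= t].
Proof.
move=> e0; have [d1 d10 H1] := graph_expansion e0.
have [d2 d20 H2] := graph_local.
pose d := Num.min 2^-1 (Num.min d1 d2).
have d0 : 0 < d by rewrite !lt_min d10 d20 invr_gt0 ltr0n.
exists d; first by rewrite d0 gt_min invf_lt1// ltr1n.
move=> t v t0 tv1; set u := consv (t, v) *m O => rho.
have u0 : u != 0 by rewrite -enorm_eq0 enorm_mulmx// tv1 oner_eq0.
have r0 : 0 <= rho := radial_function_ge0 cK Kz u0.
have ptE l : z + l *: u = pt (consv (l * t, l *: v)).
  by rewrite /pt -consvZ -scalemxAl.
have [t1 v1] : `|t| <= 1 /\ `|v| <= 1.
  rewrite -tv1 norm_le_consv; split=> //.
  by rewrite (le_trans (mxnorm_le_enorm v))// enorm_le_consv.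
set Gp := half_form kappa v + e * enorm v ^+ 2.
set Gm := half_form kappa v - e * enorm v ^+ 2.
have small l : 0 < l < d -> [/\ `|l * t| < d2, `|l *: v| < d2 &
    l ^+ 2 * Gm <= f (l *: v) <= l ^+ 2 * Gp].
  move=> /andP[l0]; rewrite !lt_min => /and3P[_ ld1 ld2].
  have lv : `|l *: v| <= l by rewrite normrZ gtr0_norm// ler_piMr// ltW.
  split.
  - by rewrite normrM gtr0_norm// (le_lt_trans _ ld2)// ler_piMr// ltW.
  - exact: le_lt_trans ld2.
  - have := H1 _ (le_lt_trans lv ld1); rewrite half_formZ enormZ (gtr0_norm l0) exprMn.
    by rewrite ler_norml /Gm /Gp => /andP[]; lra.
have up l : 0 < l < d -> l * Gp < t -> l <= rho.
  move=> ld lG; have [lt lv /andP[_ fl]] := small _ ld.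
  apply: radial_function_max => //; rewrite ptE; apply: (proj1 (H2 _ _ lt lv)).
  by rewrite (le_lt_trans fl)// expr2 -mulrA ltr_pM2l//; case/andP : ld.
have dn l : 0 < l < d -> l <= rho -> l * Gm <= t.
  move=> ld lr; rewrite leNgt; apply/negP => tG.
  have [lt lv /andP[fl _]] := small _ ld; have l0 : 0 < l by case/andP : ld.
  apply: (proj2 (H2 _ _ lt lv)).
    by rewrite (lt_le_trans _ fl)// expr2 -mulrA ltr_pM2l.
  rewrite -ptE; apply: radial_function_segment => //.
  by rewrite ltW.
have A : rho < d -> t <= rho * Gp.
  move=> rd; rewrite leNgt; apply/negP => rt.
  pose g := `|Gp| + 1; have g0 : 0 < g by rewrite ltr_wpDl.
  (* A step beyond [rho] that stays below [d] and still satisfies the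
     hypothesis of [up]. *)
  pose h := Num.min (d - rho) ((t - rho * Gp) / g) / 2.
  have M0 : 0 < Num.min (d - rho) ((t - rho * Gp) / g).
    by rewrite lt_min subr_gt0 rd divr_gt0// subr_gt0.
  have h0 : 0 < h by rewrite divr_gt0.
  have : h < Num.min (d - rho) ((t - rho * Gp) / g).
    by rewrite ltr_pdivrMr// ltr_pMr// ltr1n.
  rewrite lt_min ltr_pdivlMr// => /andP[hd hg].
  have : rho + h <= rho.
    apply: up; first by apply/andP; split; lra.
    have : h * Gp <= h * g by rewrite ler_pM2l// /g; have := ler_norm Gp; lra.
    by lra.
  by rewrite gerDl leNgt h0.
split=> //.
  rewrite lt_def r0 andbT; apply: contraTneq t0 => r_eq0.
  by rewrite -leNgt (le_trans (A _))// r_eq0// mul0r.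
rewrite leNgt; apply/negP => tG.
set r := Num.min rho d in tG.
have r0' : 0 <= r by rewrite le_min r0 ltW.
have Gm0 : 0 < Gm.
  by rewrite ltNge; apply/negP => G0; have := mulr_ge0_le0 r0' G0; lra.
pose l := (t / Gm + r) / 2.
have tr : t / Gm < r by rewrite ltr_pdivrMr.
have tG0 : 0 < t / Gm by rewrite divr_gt0.
have lr : l < r by rewrite /l; lra.
have : l * Gm <= t.
  apply: dn.
    apply/andP; split; first by rewrite /l; lra.
    by rewrite (lt_le_trans lr)// ge_min lexx orbT.
  by rewrite (le_trans (ltW lr))// ge_min lexx.
by rewrite -ler_pdivlMr// leNgt => /negP; apply; rewrite /l; lra.
Qed.
End graph.

(** * Inequalities between powers *)

Section power_inequalities.
Context {R : realType}.

Lemma le_powR_neg (x y p : R) : 0 < x -> x <= y -> p <= 0 -> y `^ p <= x `^ p.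
Proof.
move=> x0 xy p0; rewrite -[p]opprK !(powRN _ (- p)) lef_pV2 ?posrE ?powR_gt0//; last exact: lt_le_trans xy.
by apply: ge0_ler_powR; rewrite ?oppr_ge0 ?nnegrE ?(ltW x0) ?(le_trans (ltW x0) xy).
Qed.

(** Young's inequality for the product of [x^(1 - q)] and [1]: the power is
    replaced by an affine function of [x], which keeps the later integrals
    explicit. *)
Lemma powR_onem_le (x q : R) : 0 <= x -> 0 < q < 1 -> x `^ (1 - q) <= x + q.
Proof.
move=> x0 /andP[q0 q1]; have q1' : 0 < 1 - q by rewrite subr_gt0.
have := @conjugate_powR R (x `^ (1 - q)) 1 (1 - q)^-1 q^-1 (powR_ge0 _ _) ler01.
rewrite !invr_gt0 !invrK subrK => /(_ q1' q0 erefl).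
rewrite mulr1 -powRrM mulfV ?gt_eqF// powRr1// powR1 mul1r => /le_trans; apply.
by rewrite lerD2r ler_piMr// gerBl ltW.
Qed.

(** Below the threshold, [rho^(q - 1)] is [t^(q - 1)] times the power [1 - q] of
    [t / rho], which is at most [G]. *)
Lemma powR_subr1_upper (rho d t q G : R) : 0 < q < 1 -> 0 < rho -> 0 < d < 1 -> 0 < t -> 0 <= G ->
  (rho < d -> t <= rho * G) -> rho `^ (q - 1) <= d^-1 + t `^ (q - 1) * (G + q).
Proof.
move=> /andP[q0 q1] r0 /andP[d0 d1] t0 G0 H.
have q10 : q - 1 <= 0 by rewrite subr_le0 ltW.
have T0 : 0 <= t `^ (q - 1) * (G + q) by rewrite mulr_ge0 ?powR_ge0// addr_ge0// ltW.
have [/H {}H|dr] := ltP rho d.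
  rewrite -[leLHS]add0r lerD ?invr_ge0 ?(ltW d0)//.
  have s0 : 0 < t / rho by rewrite divr_gt0.
  have -> : rho = t * (t / rho)^-1 by rewrite invf_div mulrCA mulfV ?mulr1 ?gt_eqF.
  rewrite powRM ?invr_ge0 ?(ltW t0) ?(ltW s0)// ler_wpM2l ?powR_ge0//.
  rewrite -powR_inv1 ?(ltW s0)// -powRrM mulN1r opprB.
  rewrite (le_trans (powR_onem_le (ltW s0) _)) ?q0// lerD2r.
  by rewrite ler_pdivrMr// mulrC.
rewrite -[leLHS]addr0 lerD//.
rewrite (le_trans (le_powR_neg d0 dr q10))// -powR_inv1 ?(ltW d0)//.
by rewrite ger_powR ?d0 ?(ltW d1)//; lra.
Qed.

(** Here [G^(1 - q) t^(q - 1)] is the power [q - 1] of [t / G], which is at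
    least the smaller of [rho] and [d]; the factor [M^q] turns [G^(1 - q)] into
    [G]. *)
Lemma powR_subr1_lower (rho d t q G M : R) : 0 < q < 1 -> 0 < rho -> 0 < d < 1 -> 0 < t ->
  1 <= M -> G <= M -> Num.min rho d * G <= t ->
  G * t `^ (q - 1) <= M `^ q * (rho `^ (q - 1) + d^-1).
Proof.
move=> /andP[q0 q1] r0 /andP[d0 d1] t0 M1 GM H.
have q10 : q - 1 <= 0 by rewrite subr_le0 ltW.
have RHS0 : 0 <= M `^ q * (rho `^ (q - 1) + d^-1).
  by rewrite mulr_ge0 ?powR_ge0// addr_ge0 ?powR_ge0// invr_ge0 ltW.
have [G0|G0] := leP G 0; first by rewrite (le_trans _ RHS0)// mulr_le0_ge0// powR_ge0.
have m0 : 0 < Num.min rho d by rewrite lt_min r0.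
have -> : G = G `^ q * G `^ (1 - q).
  by rewrite -powRD ?(gt_eqF G0) ?implybT// [q + _]addrC subrK powRr1// ltW.
rewrite -mulrA ler_pM ?powR_ge0 ?mulr_ge0 ?powR_ge0//.
  by apply: ge0_ler_powR; rewrite ?nnegrE ?(ltW q0) ?(ltW G0) ?(le_trans (ltW G0) GM).
have -> : G `^ (1 - q) * t `^ (q - 1) = (t / G) `^ (q - 1).
  rewrite powRM ?invr_ge0 ?(ltW t0) ?(ltW G0)// mulrC; congr (_ * _).
  by rewrite -powR_inv1 ?(ltW G0)// -powRrM mulN1r opprB.
have tG : Num.min rho d <= t / G by rewrite ler_pdivlMr.
rewrite (le_trans (le_powR_neg m0 tG q10))//.
rewrite minEle; case: ifP => _; first by rewrite lerDl invr_ge0 ltW.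
rewrite -[leLHS]add0r lerD ?powR_ge0// -powR_inv1 ?(ltW d0)//.
by rewrite ger_powR ?d0 ?(ltW d1)//; lra.
Qed.

End power_inequalities.

(** * Integration over regions under a graph *)

Section tonelli.
Context {R : realType}.
Local Notation lam := (@lebesgue_measure R).

Definition tail n (x : 'rV[R]_n.+1) : 'rV[R]_n := \row_j x ord0 (lift ord0 j).

Lemma head_consv n t (v : 'rV[R]_n) : consv (t, v) ord0 ord0 = t.
Proof. by rewrite mxE unlift_none. Qed.

Lemma tail_consv n t (v : 'rV[R]_n) : tail (consv (t, v)) = v.
Proof. by apply/rowP => j; rewrite !mxE liftK. Qed.

Lemma measurable_tail n : measurable_fun setT (@tail n).
Proof.
apply: measurable_fun_rV => j.
under [X in measurable_fun _ X]eq_fun do rewrite mxE.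
exact: measurable_coord.
Qed.

Lemma integral_consv n (g : 'rV[R]_n.+1 -> \bar R) : measurable_fun setT g ->
  (forall x, (0 <= g x)%E) ->
  (\int[lebesgue_rV n.+1]_x g x = \int[lebesgue_rV n]_v \int[lam]_t g (consv (t, v)))%E.
Proof.
move=> mg g0.
have mgc : measurable_fun setT (g \o @consv R n) by apply: measurableT_comp => //; exact: measurable_consv.
transitivity (\int[product_measure1 lam (lebesgue_rV n)]_p (g \o @consv R n) p)%E.
  rewrite -[in RHS](preimage_setT (@consv R n)).
  rewrite -(@ge0_integral_pushforward _ _ _ _ R _ (@measurable_consv R n))//.
transitivity (\int[lam]_t \int[lebesgue_rV n]_v (g \o @consv R n) (t, v))%E.
  by apply: (@fubini_tonelli1 _ _ _ _ _ lam (lebesgue_rV n) _ mgc) => p; exact: g0.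
by apply: (@fubini_tonelli _ _ _ _ _ lam (lebesgue_rV n) _ mgc) => p; exact: g0.
Qed.

Definition subgraph n (V : set 'rV[R]_n) (tau : 'rV[R]_n -> R) : set 'rV[R]_n.+1 :=
  [set x | V (tail x) /\ 0 < x ord0 ord0 <= tau (tail x)].

Lemma measurable_subgraph n (V : set 'rV[R]_n) (tau : 'rV[R]_n -> R) : measurable V ->
  measurable_fun setT tau -> measurable (subgraph V tau).
Proof.
move=> mV mtau.
pose s := (fun x : 'rV[R]_n.+1 => x ord0 ord0).
have ms : measurable_fun setT s by exact: measurable_coord.
have mt : measurable_fun setT (fun x => tau (tail x)).
  by apply: measurableT_comp => //; exact: measurable_tail.
rewrite (_ : subgraph V tau = (@tail n @^-1` V) `&` (s @^-1` `]0, +oo[) `&`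
   ((fun x => tau (tail x) - s x) @^-1` `[0, +oo[)); last first.
  apply/seteqP; split => x /=; rewrite /subgraph/= !in_itv/= !andbT subr_ge0.
    by move=> [? /andP[]].
  by move=> [[? ->]].
apply: measurableI; first apply: measurableI.
- exact: measurable_pre (@measurable_tail n) mV.
- by rewrite -[X in measurable X]setTI; apply: ms.
- by rewrite -[X in measurable X]setTI; apply: measurable_funB.
Qed.

(** Tonelli, integrating first in the height, where the power of [t] has the
    explicit primitive [t^q / q]. *)
Lemma integral_subgraph_powR n (V : set 'rV[R]_n) (tau h : 'rV[R]_n -> R) (q : R) :
  measurable V -> measurable_fun setT tau -> (forall v, 0 <= tau v) ->
  measurable_fun setT h -> (forall v, 0 <= h v) -> 0 < q ->
  (\int[lebesgue_rV n.+1]_(x in subgraph V tau) (x ord0 ord0 `^ (q - 1) * h (tail x))%:E =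
   \int[lebesgue_rV n]_(v in V) (h v * (tau v `^ q / q))%:E)%E.
Proof.
move=> mV mtau tau0 mh h0 q0.
have mg : measurable_fun setT (fun x : 'rV[R]_n.+1 => (x ord0 ord0 `^ (q - 1) * h (tail x))%:E).
  apply/measurable_EFinP; apply: measurable_funM.
    by apply: (measurableT_comp (measurable_powR _ )); exact: measurable_coord.
  by apply: measurableT_comp => //; exact: measurable_tail.
have mS := measurable_subgraph mV mtau.
rewrite integral_mkcond integral_consv; last 2 first.
- apply/(measurable_restrictT _ mS); exact: measurable_funS mg.
- by move=> x; apply: erestrict_ge0 => y _; rewrite lee_fin mulr_ge0 ?powR_ge0.
rewrite [RHS]integral_mkcond; apply: eq_integral => v _.
rewrite patchE; case: ifPn => [|/negP]; rewrite inE => vV; last first.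
  rewrite integral0_eq// => t _; rewrite patchE ifF//; apply/negbTE/negP.
  by rewrite inE /subgraph/= tail_consv => -[].
have := tau0 v; rewrite le_eqVlt => /predU1P[tv|tv].
  rewrite -tv powR0 ?gt_eqF// mul0r mulr0 integral0_eq// => t _.
  rewrite patchE ifF//; apply/negbTE/negP; rewrite inE /subgraph/= tail_consv head_consv -tv.
  by move=> [_ /andP[/lt_le_trans h1 /h1]]; rewrite ltxx.
rewrite EFinM -integral_powR// -ge0_integralZl_EFin//; last 2 first.
- by move=> x _; rewrite lee_fin powR_ge0.
- by apply: measurable_funTS; apply/measurable_EFinP; exact: measurable_powR.
rewrite [RHS]integral_mkcond; apply: eq_integral => t _.
rewrite !patchE (_ : (consv (t, v) \in _) = (t \in `]0%R, tau v]%classic)).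
  by case: ifP => // _; rewrite tail_consv head_consv -EFinM mulrC.
by apply/idP/idP; rewrite !inE /subgraph/= tail_consv head_consv in_itv/= => // -[].
Qed.
End tonelli.

(** * Upper and lower bounds for the integral over the half ball *)

Section estimates.
Context {R : realType} {m : nat}.
Local Notation lam := (@lebesgue_measure R).
Variables (rho : 'rV[R]_m.+1 -> R) (kappa : 'rV[R]_m).
Hypothesis k0 : forall i, 0 <= kappa ord0 i.

Definition half_ball : set 'rV[R]_m.+1 := [set x : 'rV[R]_m.+1 | 0 < x ord0 ord0 /\ enorm x <= 1].

Hypothesis mrho : measurable_fun half_ball (fun x => rho (radial x)).

(** What the estimates use of the geometry: [rho] is the radial function read in
    the frame at [z], [e] the error allowed in the quadratic form, and [d] the
    length up to which the second order expansion is used. *)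
Definition radial_bounds (e d : R) := 0 < d < 1 /\
  forall t v, 0 < t -> enorm (consv (t, v)) = 1 ->
  [/\ 0 < rho (consv (t, v)),
      rho (consv (t, v)) < d ->
        t <= rho (consv (t, v)) * (half_form kappa v + e * enorm v ^+ 2) &
      Num.min (rho (consv (t, v))) d * (half_form kappa v - e * enorm v ^+ 2) <= t].

Local Notation om := (@ball_volume R m).
Let om0 : 0 < om := ball_volume_gt0 m.

Lemma measurable_half_ball : measurable half_ball.
Proof.
rewrite (_ : half_ball = ((fun x : 'rV[R]_m.+1 => x ord0 ord0) @^-1` `]0, +oo[) `&` ballr 1).
  apply: measurableI; last exact: measurable_ballr.
  by rewrite -[X in measurable X]setTI; apply: measurable_coord.
by apply/seteqP; split => x; rewrite /half_ball/ballr/= in_itv/= andbT.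
Qed.

Let V q := (\int[lebesgue_rV m.+1]_(x in half_ball) (rho (radial x) `^ (q - 1))%:E)%E.

Let mpow q D : D `<=` half_ball -> measurable D ->
  measurable_fun D (fun x => (rho (radial x) `^ (q - 1))%:E).
Proof.
move=> DH mD; apply/measurable_EFinP.
apply: (measurableT_comp (measurable_powR _)); 
by apply: (measurable_funS measurable_half_ball).
Qed.

Let radial_consv t (v : 'rV[R]_m) : let r := enorm (consv (t, v)) in
  radial (consv (t, v)) = consv (t / r, r^-1 *: v).
Proof. by move=> r; rewrite /radial consvZ [_ * t]mulrC. Qed.

Let enorm_radial (x : 'rV[R]_m.+1) : 0 < enorm x -> enorm (radial x) = 1.
Proof.
by move=> x0; rewrite /radial enormZ gtr0_norm ?invr_gt0// mulVf// gt_eqF.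
Qed.

(** Half the form with shifted curvatures is [k(v) + e |v|^2]. *)
Let shifted e : 'rV[R]_m := \row_i (kappa ord0 i + 2 * e).

Let half_form_shifted e v : half_form (shifted e) v = half_form kappa v + e * enorm v ^+ 2.
Proof.
rewrite /half_form sqr_enorm /dotv !mulr_sumr -big_split/=; apply: eq_bigr => i _.
by rewrite mxE; lra.
Qed.

(** The direction of [x] is [x / r] with [r = |x|], and [powR_subr1_upper]
    applies to it. The powers of [r] that appear are removed by
    [r^(1 - q) <= r + q] and [|v| <= r]. *)
Lemma radial_powR_upper e d q t v : 0 < e -> radial_bounds e d -> 0 < q < 1 ->
  half_ball (consv (t, v)) ->
  rho (radial (consv (t, v))) `^ (q - 1) <= d^-1 + t `^ (q - 1) *
    (half_form (shifted e) v / enorm v + q * (\sum_i shifted e ord0 i + 2)).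
Proof.
move=> e0 [d01 H] q01 []; rewrite head_consv => t0.
set r := enorm (consv (t, v)) => r1.
have tr : t <= r by rewrite (le_trans (ler_norm _))// norm_le_consv.
have vr : enorm v <= r := enorm_le_consv t v.
have r0 : 0 < r by exact: lt_le_trans tr.
have := H (t / r) (r^-1 *: v); rewrite -radial_consv divr_gt0// enorm_radial// => /(_ erefl erefl).
have s0 i : 0 <= shifted e ord0 i.
  by rewrite mxE addr_ge0// mulr_ge0// ltW.
rewrite -half_form_shifted => -[p0 H1 _].
have [q0 q1] := andP q01.
have G0 : 0 <= half_form (shifted e) (r^-1 *: v) by exact: half_form_ge0.
apply: (le_trans (powR_subr1_upper q01 p0 d01 _ G0 H1)); first by rewrite divr_gt0.
rewrite lerD2l half_formZ.
set G := half_form _ v; set C := \sum_i _.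
have GC : r^-1 ^+ 2 * G <= C.
  rewrite exprVn ler_pdivrMl ?exprn_gt0// (le_trans (half_form_le v s0))// mulrC.
  by rewrite ler_wpM2r ?sumr_ge0// lerXn2r ?nnegrE ?enorm_ge0 ?(ltW r0).
have GE : 0 <= G by exact: half_form_ge0.
rewrite powRM ?invr_ge0 ?(ltW t0) ?(ltW r0)// -mulrA ler_wpM2l ?powR_ge0//.
rewrite -powR_inv1 ?(ltW r0)// -powRrM mulN1r opprB powR_inv1 ?(ltW r0)//.
have rq := powR_onem_le (ltW r0) q01.
have Grr : r * (r^-1 ^+ 2 * G) = G / r by field; rewrite gt_eqF.
have Gv : G / r <= G / enorm v.
  have := enorm_ge0 v; rewrite le_eqVlt => /predU1P[v0|v0].
    have : v == 0 by rewrite -enorm_eq0 -v0.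
    move=> /eqP v00; rewrite /G v00 -(scale0r 0) half_formZ expr0n/= mul0r !mul0r//.
  by rewrite ler_wpM2l// lef_pV2 ?posrE.
have GG0 : 0 <= r^-1 ^+ 2 * G by rewrite mulr_ge0// sqr_ge0.
apply: (@le_trans _ _ ((r + q) * (r^-1 ^+ 2 * G + q))).
  by rewrite ler_wpM2r// addr_ge0// ltW.
have : q * (r^-1 ^+ 2 * G) <= q * C by rewrite ler_pM2l.
have : r * q <= q by rewrite ler_piMl// ltW.
have : q * q <= q by rewrite ler_piMl// ltW.
rewrite mulrDl !mulrDr Grr; lra.
Qed.

(** The half ball is enlarged to the cylinder [|v| <= 1, 0 < t <= 1], on which
    the bound of [radial_powR_upper] integrates explicitly. *)
Lemma dual_integral_upper e d q : 0 < e -> radial_bounds e d -> 0 < q < 1 ->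
  (q%:E * V q <= (q * om / d + 2^-1 * (\sum_i shifted e ord0 i) * (om / m.+1%:R)
     + q * (\sum_i shifted e ord0 i + 2) * om)%:E)%E.
Proof.
move=> e0 hb q01; have [d01 _] := hb; have [q0 q1] := andP q01; have [d0 d1] := andP d01.
have s0 i : 0 <= shifted e ord0 i.
  by rewrite mxE addr_ge0// mulr_ge0// ltW.
set C := \sum_i shifted e ord0 i.
have C0 : 0 <= C by apply: sumr_ge0.
pose h v := half_form (shifted e) v / enorm v + q * (C + 2).
have h0 v : 0 <= h v.
  apply: addr_ge0; first by rewrite mulr_ge0 ?invr_ge0 ?enorm_ge0 ?half_form_ge0.
  by rewrite mulr_ge0 ?(ltW q0)// addr_ge0.
have mh0 : measurable_fun setT (fun v : 'rV[R]_m => half_form (shifted e) v / enorm v).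
  by apply: measurable_funM; [exact: measurable_half_form|exact: measurable_enormV].
have mh : measurable_fun setT h by apply: measurable_funD.
pose S := @subgraph R m (ballr 1) (cst 1).
have mB : measurable (@ballr R m 1) by exact: measurable_ballr.
have mS : measurable S by apply: measurable_subgraph.
have HS : half_ball `<=` S.
  move=> x; rewrite [x]consv_surj -/(tail x) => -[]; rewrite /S/subgraph/= tail_consv head_consv.
  move=> x0 x1; split; first by rewrite /ballr/= (le_trans (enorm_le_consv _ _) x1).
  by rewrite x0 (le_trans (ler_norm _))// (le_trans (norm_le_consv _ _) x1).
(* The constant [d^-1] is written with a power of exponent [1 - 1], so that
   [integral_subgraph_powR] covers both terms. *)
pose I1 (x : 'rV[R]_m.+1) := (x ord0 ord0 `^ (1 - 1) * d^-1)%:E : \bar R.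
pose I2 (x : 'rV[R]_m.+1) := (x ord0 ord0 `^ (q - 1) * h (tail x))%:E.
have mI1 : measurable_fun setT I1.
  apply/measurable_EFinP; apply: measurable_funM => //.
  by apply: (measurableT_comp (measurable_powR _ )); exact: measurable_coord.
have mI2 : measurable_fun setT I2.
  apply/measurable_EFinP; apply: measurable_funM => //.
    by apply: (measurableT_comp (measurable_powR _ )); exact: measurable_coord.
  by apply: measurableT_comp => //; exact: measurable_tail.
have I10 x : (0 <= I1 x)%E.
  by rewrite lee_fin mulr_ge0 ?powR_ge0// invr_ge0 ltW.
have I20 x : (0 <= I2 x)%E by rewrite lee_fin mulr_ge0 ?powR_ge0.
have VI : (V q <= \int[lebesgue_rV m.+1]_(x in S) (I1 x + I2 x))%E.
  apply: (@le_trans _ _ (\int[lebesgue_rV m.+1]_(x in half_ball) (I1 x + I2 x))%E); last first.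
    apply: ge0_subset_integral => //; first exact: measurable_half_ball.
      by apply: measurable_funTS; exact: emeasurable_funD.
    by move=> x _; rewrite adde_ge0.
  apply: ge0_le_integral; first exact: measurable_half_ball.
  - by move=> x _; rewrite lee_fin powR_ge0.
  - by apply: mpow => //; exact: measurable_half_ball.
  - by apply: measurable_funTS; exact: emeasurable_funD.
  - move=> x; rewrite [x]consv_surj -/(tail x) => xH.
    rewrite -EFinD lee_fin subrr powRr0 mul1r tail_consv [in X in _ <= _ + X]head_consv.
    exact: radial_powR_upper.
apply: (@le_trans _ _ (q%:E * \int[lebesgue_rV m.+1]_(x in S) (I1 x + I2 x))%E).
  by rewrite lee_pmul2l// ?lte_fin.
rewrite ge0_integralD//; try exact: measurable_funTS.
have volB : lebesgue_rV m (@ballr R m 1) = om%:E.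
  by rewrite volume_ballr// expr1n mul1r.
have -> : (\int[lebesgue_rV m.+1]_(x in S) I1 x = (d^-1 * om)%:E)%E.
  rewrite (@integral_subgraph_powR _ _ _ _ (cst d^-1))//; last first.
    by move=> v; rewrite invr_ge0 ltW.
  rewrite (eq_integral (cst (d^-1)%:E)); last first.
    by move=> v _; rewrite /= powR1 divr1 mulr1.
  transitivity ((d^-1)%:E * lebesgue_rV m (@ballr R m 1))%E; first exact: integral_cst.
  by rewrite volB.
have -> : (\int[lebesgue_rV m.+1]_(x in S) I2 x = (q^-1 * (2^-1 * C * (om / m.+1%:R) + q * (C + 2) * om))%:E)%E.
  rewrite integral_subgraph_powR//.
  rewrite (eq_integral (fun v : 'rV[R]_m => (q^-1)%:E * (h v)%:E)%E); last first.
    by move=> v _; rewrite /= powR1 mul1r mulrC EFinM.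
  rewrite ge0_integralZl_EFin//; last 3 first.
  - by move=> v _; rewrite lee_fin.
  - by apply: measurable_funTS; apply/measurable_EFinP.
  - by rewrite invr_ge0 ltW.
  rewrite EFinM; congr (_ * _)%E; rewrite /h.
  rewrite (eq_integral (fun v : 'rV[R]_m => (half_form (shifted e) v / enorm v)%:E + (q * (C + 2))%:E)%E)//.
  rewrite ge0_integralD//.
  - rewrite integral_half_form_ballr// expr1n mul1r EFinD; congr (_ + _)%E.
    transitivity ((q * (C + 2))%:E * lebesgue_rV m (@ballr R m 1))%E; first exact: integral_cst.
    by rewrite volB.
  - by move=> v _; rewrite lee_fin mulr_ge0 ?invr_ge0 ?enorm_ge0 ?half_form_ge0.
  - by apply: measurable_funTS; apply/measurable_EFinP.
  - by move=> v _; rewrite lee_fin mulr_ge0 ?addr_ge0// ltW.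
rewrite -EFinD -EFinM lee_fin mulrDr mulVKf ?gt_eqF//.
by rewrite addrA [d^-1 * _]mulrC !mulrA.
Qed.
(** In the region considered [|x| <= (1 + c) |v|], which bounds the negative
    powers of [|x|] from below by powers of [|v|] alone. *)
Lemma radial_powR_lower e d q c t v : 0 < e -> radial_bounds e d -> 0 < q < 1 ->
  0 < c -> 0 < t <= c * enorm v -> enorm (consv (t, v)) <= 1 ->
  t `^ (q - 1) * (half_form kappa v * ((1 + c) ^- 2 * enorm v `^ (- 1 - q))) <=
  (\sum_i kappa ord0 i + 1) `^ q * (rho (radial (consv (t, v))) `^ (q - 1) + d^-1)
   + e * t `^ (q - 1).
Proof.
move=> e0 [d01 H] q01 c0 /andP[t0 tc].
set r := enorm (consv (t, v)) => r1.
have v0 : 0 < enorm v by rewrite -(pmulr_rgt0 _ c0) (lt_le_trans t0).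
have tr : t <= r by rewrite (le_trans (ler_norm _))// norm_le_consv.
have vr : enorm v <= r := enorm_le_consv t v.
have r0 : 0 < r by exact: lt_le_trans tr.
have rL : r <= (1 + c) * enorm v.
  rewrite (le_trans (consv_le _ _))// gtr0_norm// mulrDl mul1r addrC.
  by rewrite lerD2l.
have := H (t / r) (r^-1 *: v); rewrite -radial_consv divr_gt0// enorm_radial// => /(_ erefl erefl).
move=> [p0 _ H1].
have [q0 q1] := andP q01.
set M := \sum_i kappa ord0 i + 1.
have S0 : 0 <= \sum_i kappa ord0 i by exact: sumr_ge0.
have M1 : 1 <= M by rewrite lerDr.
have vu1 : enorm (r^-1 *: v) <= 1.
  by rewrite enormZ gtr0_norm ?invr_gt0// ler_pdivrMl// mulr1.
have vu2 : enorm (r^-1 *: v) ^+ 2 <= 1 by rewrite exprn_ile1// enorm_ge0.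
set ku := half_form kappa (r^-1 *: v) in H1.
have kM : ku - e * enorm (r^-1 *: v) ^+ 2 <= M.
  have : 0 <= e * enorm (r^-1 *: v) ^+ 2 by rewrite mulr_ge0 ?sqr_ge0 ?(ltW e0).
  have : ku <= (\sum_i kappa ord0 i) * 1.
    by rewrite (le_trans (half_form_le _ k0))// ler_wpM2l.
  by rewrite /M; lra.
have tu0 : 0 < t / r by rewrite divr_gt0.
have := powR_subr1_lower q01 p0 d01 tu0 M1 kM H1.
set T := (t / r) `^ (q - 1); set RHS := M `^ q * _ => HT.
have T0 : 0 <= T by exact: powR_ge0.
have TE : T = t `^ (q - 1) * r `^ (1 - q).
  rewrite /T powRM ?invr_ge0 ?(ltW t0) ?(ltW r0)//; congr (_ * _).
  by rewrite -powR_inv1 ?(ltW r0)// -powRrM mulN1r opprB.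
have TT : T <= t `^ (q - 1).
  rewrite TE ler_piMr ?powR_ge0//.
  by rewrite -[leRHS](powRr0 r); apply: ger_powR; [rewrite r0|lra].
have kT : ku * T <= RHS + e * t `^ (q - 1).
  have : e * T <= e * t `^ (q - 1) by rewrite ler_pM2l.
  have : enorm (r^-1 *: v) ^+ 2 * (e * T) <= 1 * (e * T).
    by rewrite ler_wpM2r// mulr_ge0// ltW.
  by move: HT; lra.
apply: le_trans kT.
rewrite /ku half_formZ TE.
have -> : r^-1 ^+ 2 * half_form kappa v * (t `^ (q - 1) * r `^ (1 - q)) =
  t `^ (q - 1) * (half_form kappa v * r `^ (- 1 - q)).
  have -> : r `^ (- 1 - q) = r^-1 ^+ 2 * r `^ (1 - q).
    rewrite exprVn -(powR_invn 2 (ltW r0)).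
    by rewrite -powRD ?(gt_eqF r0) ?implybT//; congr (_ `^ _); lra.
  by ring.
rewrite ler_wpM2l ?powR_ge0// ler_wpM2l ?half_form_ge0//.
have L1 : 1 <= 1 + c by rewrite lerDl ltW.
have L0 : 0 < 1 + c by exact: lt_le_trans L1.
apply: (@le_trans _ _ (((1 + c) * enorm v) `^ (- 1 - q))); last first.
  by apply: le_powR_neg => //; lra.
rewrite powRM ?(ltW L0) ?enorm_ge0// ler_wpM2r ?powR_ge0//.
by rewrite -(powR_invn 2 (ltW L0)) ler_powR//; lra.
Qed.

(** The half ball is shrunk to [|v| <= 1/(1 + c), 0 < t <= c |v|]. The error
    terms stay on the side of the unknown integral to keep all integrands
    nonnegative. *)
Lemma dual_integral_lower e d q c : 0 < e -> radial_bounds e d -> 0 < q < 1 ->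
  0 < c <= 1 ->
  (((1 + c) ^- 2 * c `^ q * (2^-1 * (\sum_i kappa ord0 i) *
      ((1 + c)^-1 ^+ m.+1 * om / m.+1%:R)))%:E <=
   ((\sum_i kappa ord0 i + 1) `^ q)%:E * (q%:E * V q + (q * om / d)%:E) + (e * om)%:E)%E.
Proof.
move=> e0 hb q01 /andP[c0 c1]; have [d01 _] := hb; have [q0 q1] := andP q01; have [d0 d1] := andP d01.
set M := \sum_i kappa ord0 i + 1.
set a := (1 + c)^-1.
have L0 : 0 < 1 + c by rewrite addr_gt0.
have a0 : 0 < a by rewrite invr_gt0.
have a1 : a <= 1 by rewrite invf_le1// lerDl ltW.
pose tau (v : 'rV[R]_m) := c * enorm v.
have tau0 v : 0 <= tau v by rewrite mulr_ge0 ?enorm_ge0// ltW.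
have mtau : measurable_fun setT tau.
  by apply: measurable_funM => //; exact: measurable_enorm.
have mB : measurable (@ballr R m a) by exact: measurable_ballr.
pose S := subgraph (ballr a) tau.
have mS : measurable S by apply: measurable_subgraph.
pose h (v : 'rV[R]_m) := half_form kappa v * ((1 + c) ^- 2 * enorm v `^ (- 1 - q)).
have h0 v : 0 <= h v.
  apply: mulr_ge0; first exact: half_form_ge0.
  by apply: mulr_ge0; rewrite ?powR_ge0// invr_ge0 exprn_ge0// ltW.
have mh : measurable_fun setT h.
  apply: measurable_funM; first exact: measurable_half_form.
  apply: measurable_funM => //.
  by apply: (measurableT_comp (measurable_powR _ )); exact: measurable_enorm.
have enS t v : S (consv (t, v)) -> [/\ 0 < t, t <= tau v & enorm (consv (t, v)) <= 1].
  rewrite /S/subgraph/= tail_consv head_consv /ballr/= => -[va /andP[t0 tt]]; split => //.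
  rewrite (le_trans (consv_le _ _))// gtr0_norm//.
  have : (1 + c) * enorm v <= 1 by rewrite -ler_pdivlMl// mulr1.
  by move: tt; rewrite /tau; lra.
have HS : S `<=` half_ball.
  move=> x; rewrite [x]consv_surj -/(tail x) => /enS[x0 _ x1].
  by split => //; rewrite head_consv.
have MM0 : 0 <= M `^ q := powR_ge0 _ _.
pose I (x : 'rV[R]_m.+1) := (x ord0 ord0 `^ (q - 1) * h (tail x))%:E : \bar R.
pose J1 (x : 'rV[R]_m.+1) := (rho (radial x) `^ (q - 1))%:E : \bar R.
pose J2 (x : 'rV[R]_m.+1) := (x ord0 ord0 `^ (1 - 1) * (M `^ q / d))%:E : \bar R.
pose J3 (x : 'rV[R]_m.+1) := (x ord0 ord0 `^ (q - 1) * e)%:E : \bar R.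
have mI (p : R) (g : 'rV[R]_m -> R) : measurable_fun setT g ->
   measurable_fun S (fun x => (x ord0 ord0 `^ (p - 1) * g (tail x))%:E).
  move=> mg; apply: measurable_funTS; apply/measurable_EFinP; apply: measurable_funM => //.
    by apply: (measurableT_comp (measurable_powR _ )); exact: measurable_coord.
  by apply: measurableT_comp => //; exact: measurable_tail.
have mJ1 : measurable_fun S J1 by exact: mpow.
have mJ2 : measurable_fun S J2 by apply: (mI 1 (cst (M `^ q / d))).
have mJ3 : measurable_fun S J3 by apply: (mI q (cst e)).
have J10 x : (0 <= J1 x)%E by rewrite lee_fin powR_ge0.
have J20 x : (0 <= J2 x)%E by rewrite lee_fin !mulr_ge0 ?powR_ge0// invr_ge0 ltW.
have J30 x : (0 <= J3 x)%E by rewrite lee_fin mulr_ge0 ?powR_ge0// ltW.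
have mMJ1 : measurable_fun S (fun x => (M `^ q)%:E * J1 x)%E by exact: measurable_funeM.
have IJ : (\int[lebesgue_rV m.+1]_(x in S) I x <=
  \int[lebesgue_rV m.+1]_(x in S) ((M `^ q)%:E * J1 x + J2 x + J3 x))%E.
  apply: ge0_le_integral => //.
  - by move=> x _; rewrite lee_fin mulr_ge0 ?powR_ge0.
  - exact: mI.
  - by apply: emeasurable_funD => //; exact: emeasurable_funD.
  - move=> x; rewrite [x]consv_surj -/(tail x) => /enS[x0 xt x1].
    rewrite /I /J1 /J2 /J3 -EFinM -!EFinD lee_fin subrr powRr0 mul1r head_consv tail_consv.
    have := radial_powR_lower e0 hb q01 c0 (v := tail x) (t := x ord0 ord0).
    rewrite x0 => /(_ xt x1) /le_trans; apply.
    by rewrite mulrDr [e * _]mulrC.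
have IE : (\int[lebesgue_rV m.+1]_(x in S) I x = (q^-1 * ((1 + c) ^- 2 * c `^ q * (2^-1 * (\sum_i kappa ord0 i) *
      (a ^+ m.+1 * om / m.+1%:R))))%:E)%E.
  rewrite integral_subgraph_powR//.
  rewrite (eq_integral (fun v : 'rV[R]_m => (q^-1 * ((1 + c) ^- 2 * c `^ q))%:E * (half_form kappa v / enorm v)%:E)%E); last first.
    move=> v _; rewrite -EFinM; congr EFin; rewrite /h /tau.
    have := enorm_ge0 v; rewrite le_eqVlt => /predU1P[v0|v0].
      have : v == 0 by rewrite -enorm_eq0 -v0.
      by move=> /eqP ->; rewrite -(scale0r 0) half_formZ expr0n/= !mul0r mulr0.
    rewrite powRM ?(ltW c0) ?enorm_ge0//.
    have -> : enorm v `^ (-1 - q) = (enorm v)^-1 / enorm v `^ q.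
      by rewrite powRB ?(gt_eqF v0) ?implybT// powR_inv1 ?(ltW v0).
    by field; rewrite !gt_eqF// powR_gt0.
  rewrite ge0_integralZl_EFin//.
  - by rewrite integral_half_form_ballr// -EFinM; congr EFin; ring.
  - by move=> v _; rewrite lee_fin mulr_ge0 ?invr_ge0 ?enorm_ge0 ?half_form_ge0.
  - apply: measurable_funTS; apply/measurable_EFinP; apply: measurable_funM.
      exact: measurable_half_form.
    exact: measurable_enormV.
  - by rewrite !mulr_ge0 ?powR_ge0 ?invr_ge0 ?exprn_ge0 ?(ltW q0) ?(ltW L0).
have const_le (w p : R) : 0 <= w -> 0 < p ->
   (\int[lebesgue_rV m.+1]_(x in S) (x ord0 ord0 `^ (p - 1) * w)%:E <= (w / p * om)%:E)%E.
  move=> w0 p0; rewrite (@integral_subgraph_powR _ _ _ _ (cst w))//.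
  apply: (@le_trans _ _ (\int[lebesgue_rV m]_(v in ballr a) cst (w / p)%:E v)%E).
    apply: ge0_le_integral => //.
    - move=> v _; rewrite lee_fin !mulr_ge0 ?powR_ge0// invr_ge0 ltW//.
    - apply: measurable_funTS; apply/measurable_EFinP; do 2 apply: measurable_funM => //.
      exact: (measurableT_comp (measurable_powR _ )).
    - move=> v; rewrite /ballr/= => va; rewrite lee_fin ler_wpM2l// ler_piMl ?invr_ge0 ?(ltW p0)//.
      have tau1 : tau v <= 1.
        by rewrite /tau mulr_ile1 ?enorm_ge0 ?(ltW c0)// (le_trans va).
      have : tau v `^ p <= 1 `^ p by apply: ge0_ler_powR; rewrite ?nnegrE ?(ltW p0).
      by rewrite powR1.
  have -> : (\int[lebesgue_rV m]_(v in ballr a) cst (w / p)%:E v = (w / p)%:E * lebesgue_rV m (@ballr R m a))%E.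
    exact: integral_cst.
  rewrite volume_ballr// -EFinM lee_fin ler_wpM2l//; first by rewrite divr_ge0 ?(ltW p0).
  by rewrite ler_piMl ?(ltW om0)// exprn_ile1// ltW.
have J1V : (\int[lebesgue_rV m.+1]_(x in S) ((M `^ q)%:E * J1 x) <= (M `^ q)%:E * V q)%E.
  rewrite ge0_integralZl_EFin// lee_wpmul2l ?lee_fin//.
  apply: ge0_subset_integral => //; first exact: measurable_half_ball.
  by apply: mpow => //; exact: measurable_half_ball.
move: IJ; rewrite IE ge0_integralD//; [|by move=> x _; rewrite adde_ge0// mule_ge0|exact: emeasurable_funD].
rewrite ge0_integralD//; last by move=> x _; rewrite mule_ge0.
have J2V := @const_le (M `^ q / d) 1 (divr_ge0 MM0 (ltW d0)) ltr01.
have J3V := @const_le e q (ltW e0) q0.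
move=> /le_trans /(_ (leeD (leeD J1V J2V) J3V)).
have qE : (0 <= q%:E :> \bar R)%E by rewrite lee_fin ltW.
move=> /(lee_wpmul2l qE).
rewrite -EFinM mulVKf ?gt_eqF// => /le_trans; apply.
have V0 : (0 <= V q)%E by apply: integral_ge0 => x _; rewrite lee_fin powR_ge0.
move: (V q) V0 => W W0.
rewrite !ge0_muleDr ?adde_ge0 ?mule_ge0 ?lee_fin ?divr_ge0 ?mulr_ge0 ?(ltW om0) ?(ltW q0) ?(ltW d0) ?(ltW e0) ?invr_ge0 ?(ltW d0)//.
rewrite muleCA -!EFinM divr1.
rewrite (_ : q * (M `^ q / d * om) = M `^ q * (q * om / d)); last by ring.
by rewrite (_ : q * (e / q * om) = e * om)//; field; rewrite gt_eqF.
Qed.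
End estimates.

(** * The limit of the half ball integral *)

Section limit.
Context {R : realType} {m : nat}.
Variables (rho : 'rV[R]_m.+1 -> R) (kappa : 'rV[R]_m).
Hypothesis k0 : forall i, 0 <= kappa ord0 i.
Hypothesis mrho : measurable_fun (@half_ball R m) (fun x => rho (radial x)).
Hypothesis hb : forall e, 0 < e -> exists d, radial_bounds rho kappa e d.

Lemma cvg_powRr_at0 (c : R) : 0 < c -> c `^ q @[q --> (0:R)^'+] --> (1 : R).
Proof.
move=> c0; rewrite /powR gt_eqF// -[X in _ --> X]expR0 -[X in expR X](mul0r (ln c)).
apply: cvg_at_right_filter.
apply: (@continuous_comp _ _ _ (fun q : R => q * ln c) expR); last exact: continuous_expR.
by apply: cvgMl; exact: cvg_id.
Qed.

(** For a tolerance [z], the error [e] and the slope [c] are fixed first so that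
    they cost a fraction of [z]; then [q] is taken small, which makes the terms
    depending on the threshold [d] negligible and brings [c^q] and [M^q] close to
    [1]. *)
Lemma half_ball_limit :
  (q%:E * \int[lebesgue_rV m.+1]_(x in @half_ball R m) (rho (radial x) `^ (q - 1))%:E)%E
    @[q --> (0:R)^'+] -->
  (2^-1 * (\sum_i kappa ord0 i) * (ball_volume m / m.+1%:R))%:E.
Proof.
set om := ball_volume m; set S := \sum_i _.
have om0 : 0 < om := ball_volume_gt0 m.
set kb := 2^-1 * S * _.
have S0 : 0 <= S by exact: sumr_ge0.
have kb0 : 0 <= kb by rewrite !mulr_ge0 ?invr_ge0 ?(ltW om0).
set X := (X in X q @[q --> _] --> _).
have X0 q : 0 < q -> (0 <= X q)%E.
  move=> q0; rewrite mule_ge0 ?lee_fin ?(ltW q0)//.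
  by apply: integral_ge0 => x _; rewrite lee_fin powR_ge0.
have up z : 0 < z -> \forall q \near (0:R)^'+, (X q <= (kb + z)%:E)%E.
  move=> z0; pose e := z / (2 * (om + 1)).
  have e0 : 0 < e by rewrite divr_gt0// mulr_gt0// addr_gt0.
  have eom : e * om <= z / 2.
    have -> : z / 2 = e * (om + 1) by rewrite /e; field; rewrite gt_eqF// addr_gt0.
    by rewrite ler_pM2l// lerDl.
  have [d hd] := hb e0; have [/andP[d0 _] _] := hd.
  pose C := \sum_(i < m) (kappa ord0 i + 2 * e).
  have CE : C = S + 2 * e * m%:R.
    by rewrite /C big_split/= sumr_const card_ord -[_ *+ m]mulr_natr.
  have C0 : 0 <= C by rewrite CE addr_ge0// mulr_ge0// mulr_ge0// ltW.
  pose A := om / d + (C + 2) * om.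
  have A0 : 0 <= A.
    by rewrite addr_ge0 ?divr_ge0 ?(ltW om0) ?(ltW d0)// mulr_ge0 ?(ltW om0)// addr_ge0.
  near=> q.
  have q0 : 0 < q by near: q; exact: nbhs_right_gt.
  have q1 : q < 1 by near: q; exact: nbhs_right_lt.
  have qz : q < z / (2 * (A + 1)).
    by near: q; apply: nbhs_right_lt; rewrite divr_gt0// mulr_gt0// ltr_wpDl.
  apply: le_trans (dual_integral_upper k0 mrho e0 hd _) _; first by rewrite q0.
  rewrite lee_fin; under eq_bigr do rewrite mxE.
  rewrite -/C -/om.
  have m0 : m%:R + 1 != 0 :> R by rewrite natr1.
  have -> : q * om / d + 2^-1 * C * (om / m.+1%:R) + q * (C + 2) * om =
     kb + e * om * (m%:R / m.+1%:R) + q * A.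
    by rewrite /kb /A [in 2^-1 * C]CE -natr1; field; rewrite (addrC 1) m0 gt_eqF.
  have : e * om * (m%:R / m.+1%:R) <= e * om.
    rewrite ler_piMr//; first by rewrite mulr_ge0 ?(ltW e0) ?(ltW om0).
    by rewrite ler_pdivrMr// mul1r ler_nat.
  have : q * A <= z / 2.
    have -> : z / 2 = z / (2 * (A + 1)) * (A + 1) by field; rewrite gt_eqF// ltr_wpDl.
    by apply: ler_pM; rewrite ?(ltW q0) ?(ltW qz) ?lerDl.
  by move: (m%:R / m.+1%:R) eom => w; lra.
have dn z : 0 < z -> \forall q \near (0:R)^'+, ((kb - z)%:E <= X q)%E.
  move=> z0; pose e := z / (2 * (om + 1)).
  have e0 : 0 < e by rewrite divr_gt0// mulr_gt0// addr_gt0.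
  have eom : e * om <= z / 2.
    have -> : z / 2 = e * (om + 1) by rewrite /e; field; rewrite gt_eqF// addr_gt0.
    by rewrite ler_pM2l// lerDl.
  have [d hd] := hb e0; have [/andP[d0 _] _] := hd.
  have cN : (1 + c)^-1 ^+ m.+3 * kb @[c --> (0:R)^'+] --> 1 * kb.
    apply: cvgMl; rewrite -[X in _ --> X](expr1n _ m.+3).
    have c1 : (1 + c)^-1 @[c --> (0:R)^'+] --> (1 : R).
      rewrite -[X in _ --> X]invr1; apply: cvgV; first exact: oner_neq0.
      rewrite -[X in _ --> X]addr0; apply: cvgD; first exact: cvg_cst.
      exact: cvg_at_right_filter.
    elim: m.+3 => [|k IH]; first by apply: cvg_near_cst; apply: nearW => c; rewrite !expr0.
    under eq_fun do rewrite exprS.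
    by rewrite exprS; exact: cvgM.
  have [c [c0 c1 cz]] : exists c, [/\ 0 < c, c <= 1 & kb - z / 4 < (1 + c)^-1 ^+ m.+3 * kb].
    have H : kb - z / 4 < 1 * kb by move: z0; lra.
    near (0:R)^'+ => c; exists c; split.
    - near: c; exact: nbhs_right_gt.
    - near: c; exact: nbhs_right_le.
    - near: c; exact: (cvgr_gt _ cN).
  set a := (1 + c)^-1 in cz.
  pose M := S + 1.
  have M0 : 0 < M by rewrite ltr_wpDl.
  (* [psi] is the amount by which the lower bound would fail if the integral were
     smaller than announced. *)
  have psi : c `^ q * (a ^+ m.+3 * kb) - M `^ q * (kb - z + q * (om / d)) - e * om @[q --> (0:R)^'+] -->
     1 * (a ^+ m.+3 * kb) - 1 * (kb - z + 0 * (om / d)) - e * om.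
    apply: cvgB; last exact: cvg_cst.
    apply: cvgB; first by apply: cvgMl; exact: cvg_powRr_at0.
    apply: cvgM; first exact: cvg_powRr_at0.
    apply: cvgD; first exact: cvg_cst.
    by apply: cvgMl; exact: cvg_at_right_filter.
  have psi0 : 0 < 1 * (a ^+ m.+3 * kb) - 1 * (kb - z + 0 * (om / d)) - e * om.
    by move: cz eom z0; lra.
  near=> q.
  have q0 : 0 < q by near: q; exact: nbhs_right_gt.
  have q1 : q < 1 by near: q; exact: nbhs_right_lt.
  have pq : 0 < c `^ q * (a ^+ m.+3 * kb) - M `^ q * (kb - z + q * (om / d)) - e * om.
    by near: q; exact: (cvgr_gt _ psi).
  have := dual_integral_lower (c := c) (q := q) k0 mrho e0 hd.
  rewrite q0 q1 c0 c1 => /(_ erefl erefl).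
  rewrite -[(q%:E * _)%E]/(X q).
  case: (X q) (X0 _ q0) => [x| |]//= _; last by rewrite leey.
  rewrite -(EFinD x) -EFinM -EFinD lee_fin => H; rewrite lee_fin leNgt; apply/negP => xk.
  have : M `^ q * (x + q * om / d) < M `^ q * (kb - z + q * (om / d)).
    by rewrite ltr_pM2l ?powR_gt0// mulrA ltrD2r.
  move: H; rewrite -/S -/M -/om -/a.
  have -> : (1 + c) ^- 2 * c `^ q * (2^-1 * S * (a ^+ m.+1 * om / m.+1%:R)) =
    c `^ q * (a ^+ m.+3 * kb).
    rewrite -exprVn -/a /kb (_ : m.+3 = 2 + m.+1)%N// exprD; ring.
  by move: pq; lra.
apply/fine_cvgP; split.
  have := up 1 ltr01; apply: filter_app; near=> q => Xq.
  rewrite ge0_fin_numE; last by apply: X0; near: q; exact: nbhs_right_gt.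
  by rewrite (le_lt_trans Xq)// ltry.
apply/cvgrPdist_le => z z0.
have := up _ z0; apply: filter_app; have := dn _ z0; apply: filter_app.
near=> q => /=; case: (X q) => [x| |]//=; rewrite ?leNye// !lee_fin => h1 h2.
by rewrite ler_norml; apply/andP; split; move: h1 h2; lra.
Unshelve. all: by end_near. Qed.
End limit.

(** * From the dual quermassintegral to the half ball *)

Section measurability.
Context {R : realType}.

Lemma measurable_ball_rV n (x : 'rV[R]_n) r : 0 < r -> measurable [set y : 'rV[R]_n | `|x - y| < r].
Proof.
move=> r0; rewrite (_ : [set _ | _] = \bigcap_(i in [set: 'I_n])
    (fun y : 'rV[R]_n => x ord0 i - y ord0 i) @^-1` `]- r, r[).
  apply: fin_bigcap_measurable => // i _.
  rewrite -[X in measurable X]setTI; apply: measurable_funB => //.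
  exact: measurable_coord.
apply/seteqP; split => y /=.
  move=> xy i _ /=; rewrite in_itv/= -ltr_norml.
  by have := coord_le_mxnorm (x - y) i; rewrite !mxE => /le_lt_trans; apply.
move=> H; rewrite [ltLHS]/Num.norm/= mx_normrE; apply: bigmax_lt => // -[i j] _ /=.
by rewrite ord1 !mxE; have := H j I; rewrite /= in_itv/= -ltr_norml.
Qed.

(** The sigma-algebra is the product one, so openness does not give
    measurability directly: a compact set is the intersection over [k] of finite
    unions of cubes of radius [1 / (k + 1)] covering it. *)
Lemma compact_measurable_rV n (K : set 'rV[R]_n) : compact K -> measurable K.
Proof.
move=> cK.
pose B (k : nat) (x : 'rV[R]_n) : set 'rV[R]_n := [set y | `|x - y| < k.+1%:R^-1].
have k0 (k : nat) : 0 < k.+1%:R^-1 :> R by rewrite invr_gt0.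
have cov k : exists s : seq 'rV[R]_n, {subset s <= K} /\ K `<=` \big[setU/set0]_(x <- s) B k x.
  have := cK; rewrite compact_cover => /(_ _ K (B k)) [x _||D DK KD].
  - rewrite (_ : B k x = ball x k.+1%:R^-1); first exact: ball_open.
    by rewrite -ball_normE.
  - by move=> x Kx; exists x => //; rewrite /B/= subrr normr0.
  - exists (finmap.enum_fset D); split; first exact: DK.
    by move=> y /KD[x /= xD xy]; rewrite -bigcup_seq; exists x.
have [s Hs] := choice cov.
rewrite (_ : K = \bigcap_k \big[setU/set0]_(x <- s k) B k x).
  apply: bigcapT_measurable => k; apply: bigsetU_measurable => x _.
  exact: measurable_ball_rV.
apply/seteqP; split => [y Ky k _|y Hy]; first exact: (proj2 (Hs k)).
rewrite (closure_id K).1; last exact: compact_closed.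
move=> U /nbhs_normP[e e0 eU].
have [k ke] : exists k : nat, k.+1%:R^-1 < e.
  by have [k _ H] := near_infty_natSinv_lt (PosNum e0); exists k; apply: H => /=.
have := Hy k I; rewrite -bigcup_seq => -[x /= xs xy].
exists x; split; first by have := (proj1 (Hs k)) _ xs; rewrite inE.
by apply: eU; rewrite /= distrC (lt_trans xy).
Qed.

(** For [r > 0], the radial function is at least [r] in the directions [u] for
    which [z + r u] is in [K]. *)
Lemma measurable_radial_function d (T : measurableType d) n (K : set 'rV[R]_n)
    (z : 'rV[R]_n) (g : T -> 'rV[R]_n) (A : set T) :
  compact K -> convex_set K -> K z -> measurable A -> measurable_fun setT g ->
  (forall x, A x -> g x != 0) ->
  measurable_fun A (fun x => radial_function K z (g x)).
Proof.
move=> cK vK Kz mA mg g0.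
apply: (measurability (@RGenCInfty.G R)) => [|/= _ [_] [r] -> <-].
  exact: RGenCInfty.measurableE.
have [r0|r0] := leP r 0.
  rewrite (_ : _ `&` _ = A)//; apply/seteqP; split => x /=; first by case.
  move=> Ax; split => //; rewrite /= in_itv/= andbT (le_trans r0)//.
  by apply: radial_function_ge0 => //; exact: g0.
rewrite (_ : _ `&` _ = A `&` (fun x => z + r *: g x) @^-1` K).
  apply: measurableI => //; apply: measurable_pre; last exact: compact_measurable_rV.
  have := measurableT_comp (measurable_affine_rV r%:M z) mg.
  by congr measurable_fun; apply/funext => x /=; rewrite mul_mx_scalar addrC.
apply/seteqP; split => x /= -[Ax]; rewrite in_itv/= andbT => H; split => //.
  by apply: radial_function_segment => //; [exact: g0|rewrite ltW].
by apply: radial_function_max => //; exact: g0.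
Qed.

Section reduction.
Variables (m : nat) (K : set 'rV[R]_m.+1) (z : 'rV[R]_m.+1) (O : 'M[R]_m.+1).
Hypotheses (cK : compact K) (vK : convex_set K) (Kz : K z) (OO : O *m O^T = 1%:M).
Hypothesis Opos : forall t v, 0 < t -> enorm (consv (t, v)) = 1 ->
  0 < radial_function K z (consv (t, v) *m O).
Hypothesis Oneg : forall t v, t < 0 -> radial_function K z (consv (t, v) *m O) <= 0.

Let D := positive_directions K z.

Let D0 u : D u -> u != 0.
Proof. by move=> [u1 _]; rewrite -enorm_eq0 u1 oner_eq0. Qed.

Let measurable_D : measurable D.
Proof.
rewrite (_ : D = \bigcup_k ((@enorm R m.+1 @^-1` [set 1]) `&`
   (fun u => z + k.+1%:R^-1 *: u) @^-1` K)).
  apply: bigcupT_measurable => k; apply: measurableI.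
    by rewrite -[X in measurable X]setTI; apply: measurable_enorm.
  apply: measurable_pre; last exact: compact_measurable_rV.
  have := measurable_affine_rV (k.+1%:R^-1)%:M z.
  by congr measurable_fun; apply/funext => x /=; rewrite mul_mx_scalar addrC.
apply/seteqP; split => u.
  move=> Du; have [u1 r0] := Du.
  have [k _ /(_ k (leqnn k)) /= rk] := near_infty_natSinv_lt (PosNum r0).
  exists k => //; split => //; apply: radial_function_segment => //; first exact: D0.
  by apply/andP; split; [rewrite invr_ge0|exact: ltW rk].
move=> [k _ [/= u1 Ku]]; split => //.
rewrite (@lt_le_trans _ _ k.+1%:R^-1) ?invr_gt0//.
by apply: radial_function_max => //; rewrite -enorm_eq0 u1 oner_eq0.
Qed.

(** Sending the complement of the ball to [0], which is not a direction, avoids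
   restricting the measure to the ball. *)
Let phi (x : 'rV[R]_m.+1) : 'rV[R]_m.+1 := \1_(unit_ball m.+1) x *: radial x.

Let measurable_phi : measurable_fun setT phi.
Proof.
apply: measurable_fun_rV => i.
under [X in measurable_fun _ X]eq_fun do rewrite mxE.
apply: measurable_funM.
  by apply: measurable_indic; exact: measurable_unit_ball.
apply: (measurableT_comp (measurable_coord i)); exact: measurable_radial.
Qed.

Let phi_pre (A : set 'rV[R]_m.+1) : A `<=` D ->
  phi @^-1` A = @radial R m.+1 @^-1` A `&` unit_ball m.+1.
Proof.
move=> AD; apply/seteqP; split => x /=; rewrite /phi indicE.
  have [xB|xB] := boolP (x \in _); first by rewrite scale1r; rewrite inE in xB.
  by rewrite scale0r => /AD /D0; rewrite eqxx.
by move=> [Ax xB]; rewrite mem_set// scale1r.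
Qed.

(** The surface measure is [n] times the image of the volume of the unit ball
    under [x / |x|]. In the frame [O], directions of negative height are
    excluded by [Oneg], those of zero height form a null set, and all others
    have a positive radial function by [Opos]. *)
Lemma dual_quermassintegral_half_ball p :
  dual_quermassintegral p K z =
  (\int[lebesgue_rV m.+1]_(x in @half_ball R m)
     (radial_function K z (radial x *m O) `^ p)%:E)%E.
Proof.
rewrite /dual_quermassintegral -/D.
(* [F] is made opaque to keep conversion from unfolding the supremum. *)
have [F FE] : exists F, F = (fun u => (radial_function K z u `^ p)%:E) by eexists.
rewrite -FE.
have mF : measurable_fun D F.
  rewrite FE; apply/measurable_EFinP; apply: (measurableT_comp (measurable_powR _)).
  by apply: measurable_radial_function => //; exact: D0.
have F0 u : (0 <= F u)%E by rewrite FE lee_fin powR_ge0.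
have n0 : (0 : R) <= m.+1%:R by [].
pose mu := mscale (NngNum n0) (pushforward (lebesgue_rV m.+1) phi) .
have -> : (\int[sphere_measure m.+1]_(u in D) F u =
    m.+1%:R%:E * \int[lebesgue_rV m.+1]_(x in phi @^-1` D) F (phi x))%E.
  rewrite (@eq_measure_integral _ _ _ D (mu measurable_phi)); last first.
    move=> A mA AD; rewrite /mu /= /mscale/= /pushforward phi_pre//.
  transitivity (m.+1%:R%:E *
      \int[pushforward (lebesgue_rV m.+1) phi]_(u in D) F u)%E.
    apply: (@ge0_integral_mscale _ _ _ _ D measurable_D (NngNum n0) F mF) => u _.
    exact: F0.
  apply: (congr1 (fun y => m.+1%:R%:E * y)%E).
  by apply: ge0_integral_pushforward => // u _; exact: F0.
set J := (\int[_]_(_ in phi @^-1` D) _)%E.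
have -> : ((m.+1%:R^-1)%:E * (m.+1%:R%:E * J) = J)%E.
  by move: J => J; rewrite muleA -EFinM mulVf ?mul1e.
rewrite /J {J}.
have mP : measurable (phi @^-1` D) by exact: measurable_pre.
have PE := phi_pre (@subset_refl _ D).
rewrite (eq_integral (fun x => F (radial x))); last first.
  move=> x; rewrite PE inE => -[_ xB].
  by rewrite /phi indicE (mem_set xB) scale1r.
rewrite PE in mP *.
set P := _ `&` _ in mP *.
have mFr : measurable_fun P (fun x => F (radial x)).
  rewrite FE; apply/measurable_EFinP; apply: (measurableT_comp (measurable_powR _)).
  apply: measurable_radial_function => //; first exact: measurable_radial.
  by move=> x [/D0].
rewrite [LHS](volume_preserving_integral (measurable_mulmxr O) (orthogonal_scales_volume OO))//.
have radO x : radial (x *m O) = radial x *m O.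
  by rewrite /radial enorm_mulmx// scalemxAl.
pose N : set 'rV[R]_m.+1 := (fun x : 'rV[R]_m.+1 => x ord0 ord0) @^-1` [set 0].
have mN : measurable N.
  by rewrite -[X in measurable X]setTI; apply: measurable_coord.
have N0 : lebesgue_rV m.+1 N = 0%E.
  rewrite lebesgue_rVSr// integral0_eq// => v _.
  rewrite (_ : [set _ | _] = [set 0]) ?lebesgue_measure_set1//.
  by apply/seteqP; split => t; rewrite /N/= head_consv.
have mTP : measurable ((fun x => x *m O) @^-1` P).
  by apply: measurable_pre => //; exact: measurable_mulmxr.
rewrite [LHS](ge0_negligible_integral mN)//; last first.
  have sub : (fun x : 'rV[R]_m.+1 => x *m O) @` ((fun x => x *m O) @^-1` P) `<=` P.
    by move=> _ [x Px <-].
  exact: (measurable_comp mP sub mFr (measurable_funTS (measurable_mulmxr O))).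
rewrite (_ : _ `\` N = @half_ball R m); last first.
  apply/seteqP; split => x.
    move=> [[]]; rewrite /= radO => -[_ r0] xB xN; split; last first.
      by move: xB; rewrite /unit_ball/= enorm_mulmx.
    rewrite lt_neqAle eq_sym; apply/andP; split; first by apply/eqP => xE; apply: xN.
    rewrite leNgt; apply/negP => x0; move: r0; apply/negP; rewrite -leNgt.
    rewrite [x]consv_surj /radial consvZ; apply: Oneg.
    rewrite pmulr_rlt0// invr_gt0 lt_neqAle enorm_ge0 andbT eq_sym enorm_eq0.
    apply/eqP => /rowP /(_ ord0); rewrite head_consv mxE => xE.
    by rewrite xE ltxx in x0.
  move=> [x0 x1].
  have ex : 0 < enorm x.
    by rewrite (lt_le_trans x0)// (le_trans (ler_norm _))// coord_le_enorm.
  have rx : enorm (radial x) = 1.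
    by rewrite /radial enormZ gtr0_norm ?invr_gt0// mulVf// gt_eqF.
  split; last by rewrite /N/= => xE; rewrite xE ltxx in x0.
  split; last by rewrite /unit_ball/= enorm_mulmx.
  rewrite /= radO; split; first by rewrite /unit_sphere/= enorm_mulmx.
  move: rx; rewrite [radial x]consv_surj => rx; apply: Opos => //.
  by rewrite /radial mxE mulr_gt0// invr_gt0.
by apply: eq_integral => x _; rewrite FE radO.
Qed.
End reduction.
End measurability.

(** * The limit of the dual quermassintegral *)

Theorem proposition4p13 (R : realType) (n : nat) (K : set 'rV[R]_n)
    (z : 'rV[R]_n) (kappa : 'rV[R]_n.-1) :
  (2 <= n)%N ->
  convex_body K ->
  boundary K z ->
  principal_curvatures K z kappa ->
  (q%:E * dual_quermassintegral (q - 1) K z)%E @[q --> 0^'+] -->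
    (((n%:R - 1) * ball_volume n.-1 / (2 * n%:R)) * mean_curvature kappa)%:E.
Proof.
case: n K z kappa => [|[|m]]// K z kappa _ [cK vK iK] [+ _] [nu [E [f [nuN [EE nuE] [U U0 [_ vf]] bK fo]]]].
rewrite -(closure_id K).1 => [Kz|]; last exact: compact_closed.
have [nu1 nuK] : outer_unit_normals K z nu by rewrite nuN.
have k0 i : 0 <= kappa ord0 i.
  exact: (principal_curvature_ge0 cK nu1 nuK EE nuE U0 bK fo).
pose O := frame (- nu) E.
have OO : O *m O^T = 1%:M by exact: frame_nu_orthogonal.
pose rho x := radial_function K z (x *m O).
have hb e : 0 < e -> exists d, radial_bounds rho kappa e d.
  move=> e0; have [d d01 H] := radial_function_bounds cK vK iK Kz nu1 nuK EE nuE U0 vf bK fo e0.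
  by exists d; split.
have mrho : measurable_fun (@half_ball R m.+1) (fun x => rho (radial x)).
  apply: measurable_radial_function => //; first exact: measurable_half_ball.
    apply: (measurableT_comp (measurable_mulmxr O)); exact: measurable_radial.
  move=> x [x0 _].
  have ex : 0 < enorm x.
    by rewrite (lt_le_trans x0)// (le_trans (ler_norm _))// coord_le_enorm.
  by rewrite -enorm_eq0 enorm_mulmx// /radial enormZ mulf_neq0 ?gt_eqF ?normr_gt0 ?invr_neq0 ?gt_eqF.
have -> : ((m.+2%:R - 1) * ball_volume m.+1 / (2 * m.+2%:R)) * mean_curvature kappa =
    2^-1 * (\sum_i kappa ord0 i) * (ball_volume m.+1 / m.+2%:R).
  have m1 : m.+1%:R != 0 :> R by [].
  have m2 : m.+1%:R + 1 != 0 :> R by rewrite natr1.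
  rewrite /mean_curvature/= -(natr1 m.+1) addrK.
  by move: (m.+1%:R : R) m1 m2 => w w0 w1; field; rewrite w0 ?(addrC 1) w1.
suff -> : (fun q => q%:E * dual_quermassintegral (q - 1) K z)%E =
    (fun q => q%:E * \int[lebesgue_rV m.+2]_(x in @half_ball R m.+1)
      (rho (radial x) `^ (q - 1))%:E)%E by exact: half_ball_limit k0 mrho hb.
apply/funext => q; congr (_ * _)%E; apply: dual_quermassintegral_half_ball => //.
- move=> t v t0 tv; have [d [_ H]] := hb 1 ltr01.
  by have [] := H t v t0 tv.
- move=> t v t0.
  have u0 : consv (t, v) *m O != 0.
    rewrite -enorm_eq0 enorm_mulmx// enorm_eq0; apply/eqP => /rowP /(_ ord0).
    by rewrite head_consv mxE => tE; rewrite tE ltxx in t0.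
  have := nuK _ (radial_function_mem cK Kz u0).
  rewrite addrAC subrr add0r dotvZl.
  have -> : dotv (consv (t, v) *m O) nu = - t.
    have : consv (t, v) *m O *m O^T = consv (t, v) by rewrite -mulmxA OO mulmx1.
    rewrite [_ *m O^T]mul_frame_tr => /consv_inj[+ _].
    by rewrite dotvNr => H; rewrite -(opprK (dotv _ nu)) H.
  by rewrite pmulr_lle0// oppr_gt0.
Qed.
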